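(* Let $n\ge 2$ and let $\mathbb{S}^{n-1}=\{x\in\mathbb{R}^n : \|x\|_2=1\}$ be the unit sphere, with $(n-1)$-dimensional surface measure $\mu$, total surface area $s_{n-1}=\mu[\mathbb{S}^{n-1}]$, and normalized measure $\mu_1=\mu/s_{n-1}$. Consider a classification problem with $m$ classes, where class $c\in\{1,\dots,m\}$ is described by a bounded probability density $\rho_c:\mathbb{S}^{n-1}\to[0,\infty)$ with respect to $\mu$. Let $\mathcal{C}:\mathbb{S}^{n-1}\to\{1,\dots,m\}$ be a classifier whose level sets $\{x:\mathcal{C}(x)=c\}$ are measurable. Define $V_c:=s_{n-1}\cdot\sup_x\rho_c(x)$ and $f_c:=\mu_1\{x:\mathcal{C}(x)=c\}$. Fix a class $c$ with $f_c\le \frac12$ and $\epsilon>0$, and let $x$ be a random point with density $\rho_c$. Then with probability at least $$1-V_c\left(\frac{\pi}{8}\right)^{1/2}\exp\left(-\frac{n-1}{2}\epsilon^2\right)$$ at least one of the following holds: (1) $\mathcal{C}(x)\neq c$ (i.e. $x$ is misclassified); or (2) there exists $\hat x\in\mathbb{S}^{n-1}$ with $\mathcal{C}(\hat x)\ne c$ and $d_g(x,\hat x)\le\epsilon$, where $d_g$ is the geodesic distance on $\mathbb{S}^{n-1}$.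
   Context: The geodesic distance between $x,y\in\mathbb{S}^{n-1}$ is the angle $\arccos\langle x,y\rangle$ (length of the shortest great-circle arc). A point $x$ from class $c$ is said to admit an $\epsilon$-adversarial example in a metric $d$ if there is $\hat x$ in the domain with $\mathcal{C}(\hat x)\neq c$ and $d(x,\hat x)\le\epsilon$; condition (2) is exactly this for the geodesic metric. *)

(* Defs.v *)
From HB Require Import structures.
From mathcomp Require Import all_boot all_order all_algebra.
From mathcomp Require Import all_classical all_reals all_analysis.
Set Implicit Arguments. Unset Strict Implicit. Unset Printing Implicit Defensive.
Import Order.TTheory GRing.Theory Num.Theory.
Import numFieldNormedType.Exports.
Local Open Scope classical_set_scope.
Local Open Scope ring_scope.

(* Points of R^n are represented as n-tuples of reals; n.-tuple R carries the
   library's product (= Borel) sigma-algebra. *)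

Section Defs.
Variable R : realType.

Definition dotp (n : nat) (x y : n.-tuple R) : R :=
  \sum_(i < n) tnth x i * tnth y i.
Definition enorm (n : nat) (x : n.-tuple R) : R := Num.sqrt (dotp x x).

Definition usphere (n : nat) : set (n.-tuple R) := [set x | enorm x = 1].
Arguments usphere n : clear implicits.

Definition geodist (n : nat) (x y : n.-tuple R) : R := acos (dotp x y).

Definition normalize (n : nat) (x : n.-tuple R) : n.-tuple R :=
  map_tuple (fun a => a / enorm x) x.

Definition cone (n : nat) (B : set (n.-tuple R)) : set (n.-tuple R) :=
  [set x | 0 < enorm x <= 1 /\ B (normalize x)].

(* Iterated Lebesgue integral over R^n (x_1 outermost).  By Tonelli it is
   the integral against n-dimensional Lebesgue measure for nonnegative
   measurable integrands. *)
Fixpoint iint (n : nat) : (n.-tuple R -> \bar R) -> \bar R :=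
  match n with
  | 0 => fun f => f [tuple]
  | k.+1 => fun f =>
      (\int[@lebesgue_measure R]_(t in [set: R])
         iint (fun y : k.-tuple R => f [tuple of t :: y]))%E
  end.

(* (n-1)-dimensional surface measure on S^{n-1} (cone-measure formula
   mu(B) = n * lambda_n(cone B)) *)
Definition surf (n : nat) (B : set (n.-tuple R)) : \bar R :=
  (n%:R%:E * iint (fun x => (\1_(cone B) x)%:E))%E.

(* integral of g over B against the surface measure, via polar coordinates:
   int_B g dmu = n * int_{cone B} g(x/|x|) dx *)
Definition surf_int (n : nat) (B : set (n.-tuple R)) (g : n.-tuple R -> R)
  : \bar R :=
  (n%:R%:E * iint (fun x => (\1_(cone B) x * g (normalize x))%:E))%E.

Definition sarea (n : nat) : R := fine (surf (usphere n)).
Definition surf1 (n : nat) (B : set (n.-tuple R)) : \bar R :=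
  (surf B * (sarea n)^-1%:E)%E.

Definition bounded_density (n : nat) (rho : n.-tuple R -> R) : Prop :=
  measurable_fun (usphere n) rho /\
  (forall x, usphere n x -> 0 <= rho x) /\
  (exists M : R, forall x, usphere n x -> rho x <= M) /\
  surf_int (usphere n) rho = 1%E.

End Defs.
Arguments usphere {R} n.
Arguments sarea {R} n.

(* Main.v *)
(* The class [A] of the points not classified as [c] has at least half of the
   measure of the sphere, so it suffices to show that the complement of its
   [eps]-neighbourhood has relative measure at most
   [expR (- (n - 1) / 2 * eps ^ 2) / 2].

   Isoperimetry is proved by approximate two-point symmetrization, without any
   compactness argument.  The class of the 1-Lipschitz functions [g] such that
   [g <= 0] on half of the sphere and such that [g < r] has at most a given
   measure is closed under polarization along a hyperplane.  If [g] nearly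
   minimizes the integral of [g x * (1 + <x, e>)] over this class, then no
   polarization decreases the integral by much; since the Lipschitz condition
   makes every violation of monotonicity persist on a ball, [g] is almost a
   monotone function of [<x, e>].  Applied to the distance to [A], this compares
   the neighbourhood of [A] with the cap centred at [e].

   Only the invariance of the measure under reflections is needed.  It follows
   from the uniqueness of translation invariant measures on [R^n], proved by
   applying Tonelli's theorem to [1_F y * 1_E (x + y)] for a symmetric set [F].

   Slicing the cone over a cap by the hyperplanes [x_1 = t] gives its volume as
   a function [F a] with [F' a = - (N / (N + 1)) * cos a ^ (N - 1)], where
   [N = n - 1].  For [N >= 2] the bound [F a <= expR (- N / 2 * a ^ 2) * F 0]
   holds because [x * expR (- N / 2 * x ^ 2) / cos x ^ (N - 1)] is increasing;
   for [N = 1] the function [F] is affine. *)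

Require Import Defs.
From HB Require Import structures.
From mathcomp Require Import all_boot all_order all_algebra.
From mathcomp Require Import all_classical all_reals all_analysis.
From mathcomp Require Import measurable_realfun.
From mathcomp Require Import ring lra.
Import Order.TTheory GRing.Theory Num.Theory.
Import numFieldNormedType.Exports.
Local Open Scope classical_set_scope.
Local Open Scope ring_scope.

Set Implicit Arguments.
Unset Strict Implicit.
Unset Printing Implicit Defensive.

(** * Euclidean geometry of tuples *)

Definition lincomb {R : realType} {n : nat} (a : R) (x : n.-tuple R)
  (b : R) (y : n.-tuple R) : n.-tuple R :=
  [tuple a * tnth x i + b * tnth y i | i < n].

Definition eudist {R : realType} {n : nat} (x y : n.-tuple R) : R :=
  enorm (lincomb 1 x (-1) y).

Definition mirror {R : realType} {n : nat} (u x : n.-tuple R) : n.-tuple R :=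
  lincomb 1 x (- 2 * dotp x u) u.

Section TupleGeometry.
Context {R : realType} {n : nat}.
Implicit Types (a b : R) (x y z u v : n.-tuple R).

Lemma tnth_lincomb a x b y i :
  tnth (lincomb a x b y) i = a * tnth x i + b * tnth y i.
Proof. by rewrite tnth_mktuple. Qed.

Lemma dotpC x y : dotp x y = dotp y x.
Proof. by apply: eq_bigr => i _; rewrite mulrC. Qed.

Lemma dotp_lincombl a x b y z :
  dotp (lincomb a x b y) z = a * dotp x z + b * dotp y z.
Proof.
rewrite /dotp 2!mulr_sumr -big_split /=; apply: eq_bigr => i _.
by rewrite tnth_lincomb; ring.
Qed.

Lemma dotp_lincombr a x b y z :
  dotp z (lincomb a x b y) = a * dotp z x + b * dotp z y.
Proof. by rewrite dotpC dotp_lincombl !(dotpC z). Qed.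

Definition dotp_lincomb := (dotp_lincombl, dotp_lincombr).

Lemma dotpp_ge0 x : 0 <= dotp x x.
Proof. by apply: sumr_ge0 => i _; rewrite -expr2 sqr_ge0. Qed.

Lemma enorm_ge0 x : 0 <= enorm x.
Proof. exact: sqrtr_ge0. Qed.

Lemma sqr_enorm x : enorm x ^+ 2 = dotp x x.
Proof. by rewrite sqr_sqrtr ?dotpp_ge0. Qed.

Lemma dotpp_eq0 x : dotp x x = 0 -> forall i, tnth x i = 0.
Proof.
move=> /eqP; rewrite psumr_eq0; last by move=> i _; rewrite -expr2 sqr_ge0.
move=> /allP h i; have := h i (mem_index_enum _).
by rewrite /= -expr2 sqrf_eq0 => /eqP.
Qed.

Lemma sqr_tnth_le x i : tnth x i ^+ 2 <= dotp x x.
Proof.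
rewrite /dotp (bigD1 i) //= expr2 lerDl.
by apply: sumr_ge0 => j _; rewrite -expr2 sqr_ge0.
Qed.

Lemma cauchy_schwarz x y : dotp x y ^+ 2 <= dotp x x * dotp y y.
Proof.
have [y0|y0] := eqVneq (dotp y y) 0.
  suff -> : dotp x y = 0 by rewrite expr0n mulr_ge0 ?dotpp_ge0.
  by apply: big1 => i _; rewrite (dotpp_eq0 y0 i) mulr0.
have yp : 0 < dotp y y by rewrite lt_def y0 dotpp_ge0.
have := dotpp_ge0 (lincomb (dotp y y) x (- dotp x y) y).
rewrite !dotp_lincomb (dotpC y x) => h.
rewrite -subr_ge0 -(pmulr_rge0 _ yp).
by apply: le_trans h _; rewrite le_eqVlt; apply/orP; left; apply/eqP; ring.
Qed.

Lemma dotp_le_enorm x y : dotp x y <= enorm x * enorm y.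
Proof.
have [h|h] := leP (dotp x y) 0.
  by apply: le_trans h _; rewrite mulr_ge0 ?enorm_ge0.
rewrite -ler_sqr ?nnegrE ?mulr_ge0 ?enorm_ge0 ?(ltW h)// exprMn !sqr_enorm.
exact: cauchy_schwarz.
Qed.

Lemma enorm_lincomb_le a x b y :
  enorm (lincomb a x b y) <= `|a| * enorm x + `|b| * enorm y.
Proof.
have p : 0 <= `|a| * enorm x + `|b| * enorm y.
  by rewrite addr_ge0// mulr_ge0 ?enorm_ge0.
rewrite -ler_sqr ?nnegrE ?enorm_ge0// sqr_enorm.
rewrite sqrrD !exprMn !sqr_enorm !dotp_lincomb (dotpC y x).
rewrite !real_normK ?num_real//.
suff : a * b * dotp x y <= `|a| * enorm x * (`|b| * enorm y) by lra.
apply: le_trans (ler_norm _) _.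
rewrite 2!normrM [leRHS](_ : _ = `|a| * `|b| * (enorm x * enorm y)); last by ring.
rewrite ler_wpM2l ?mulr_ge0// ler_norml dotp_le_enorm andbT.
have := dotp_le_enorm (lincomb (-1) x 0 x) y.
rewrite {1}dotp_lincomb /enorm !dotp_lincomb mul0r addr0 => h.
rewrite lerNl; apply: le_trans (_ : _ <= - 1 * dotp x y) _; first by lra.
apply: le_trans h _; rewrite le_eqVlt; apply/orP; left; apply/eqP.
by congr (Num.sqrt _ * _); ring.
Qed.

Lemma sqr_eudist x y : eudist x y ^+ 2 = dotp x x - 2 * dotp x y + dotp y y.
Proof. by rewrite sqr_enorm !dotp_lincomb (dotpC y x); ring. Qed.

Lemma eudist_ge0 x y : 0 <= eudist x y.
Proof. exact: enorm_ge0. Qed.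

Lemma eudistC x y : eudist x y = eudist y x.
Proof. by congr Num.sqrt; rewrite !dotp_lincomb (dotpC y x); ring. Qed.

Lemma eudistxx x : eudist x x = 0.
Proof.
rewrite /eudist /enorm !dotp_lincomb -[RHS]sqrtr0; congr Num.sqrt; ring.
Qed.

Lemma eudist_triangle y x z : eudist x z <= eudist x y + eudist y z.
Proof.
have -> : eudist x z =
    enorm (lincomb 1 (lincomb 1 x (-1) y) 1 (lincomb 1 y (-1) z)).
  congr Num.sqrt; congr dotp; apply: eq_from_tnth => i;
  by rewrite !tnth_lincomb; ring.
by apply: le_trans (enorm_lincomb_le _ _ _ _) _; rewrite normr1 !mul1r.
Qed.

Lemma dotpB_le_eudist x y z : dotp x z - dotp y z <= eudist x y * enorm z.
Proof.
rewrite (_ : _ - _ = dotp (lincomb 1 x (-1) y) z) ?dotp_le_enorm//.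
by rewrite dotp_lincomb; ring.
Qed.

Lemma dist_enorm_le x y : `|enorm x - enorm y| <= eudist x y.
Proof.
have e (v : n.-tuple R) : enorm v = eudist v (lincomb 0 v 0 v).
  by congr Num.sqrt; rewrite !dotp_lincomb; ring.
have e0 : lincomb 0 x 0 x = lincomb 0 y 0 y.
  by apply: eq_from_tnth => i; rewrite !tnth_lincomb; ring.
rewrite (e x) (e y) e0 ler_norml; apply/andP; split.
  have := eudist_triangle x y (lincomb 0 y 0 y); rewrite (eudistC y x); lra.
have := eudist_triangle y x (lincomb 0 y 0 y); lra.
Qed.

Lemma usphereP x : usphere n x <-> dotp x x = 1.
Proof.
split=> [h|h]; first by rewrite -sqr_enorm [enorm x]h expr1n.
by rewrite /usphere /= /enorm h sqrtr1.
Qed.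

Lemma dotp_mirror u x y : dotp u u = 1 ->
  dotp (mirror u x) (mirror u y) = dotp x y.
Proof.
by move=> u1; rewrite !dotp_lincomb u1 (dotpC u y); ring.
Qed.

Lemma mirrorK u : dotp u u = 1 -> involutive (mirror u).
Proof.
move=> u1 x; apply: eq_from_tnth => i.
by rewrite !tnth_lincomb !dotp_lincomb u1; ring.
Qed.

Lemma enorm_mirror u x : dotp u u = 1 -> enorm (mirror u x) = enorm x.
Proof. by move=> u1; rewrite /enorm dotp_mirror. Qed.

Lemma usphere_mirror u x : dotp u u = 1 ->
  usphere n (mirror u x) <-> usphere n x.
Proof. by move=> u1; rewrite !usphereP dotp_mirror. Qed.

Lemma eudist_mirror u x y : dotp u u = 1 ->
  eudist (mirror u x) (mirror u y) = eudist x y.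
Proof.
move=> u1; apply/eqP; rewrite -(@eqrXn2 _ 2) ?eudist_ge0//.
by rewrite !sqr_eudist !dotp_mirror.
Qed.

Lemma eudist_mirror_le u x y : dotp u u = 1 ->
  0 <= dotp x u * dotp y u -> eudist x y <= eudist x (mirror u y).
Proof.
move=> u1 xy; rewrite -ler_sqr ?nnegrE ?eudist_ge0//.
rewrite !sqr_eudist dotp_mirror// !dotp_lincomb; lra.
Qed.

Lemma dotp_mirror_pole u x : dotp u u = 1 ->
  dotp (mirror u x) u = - dotp x u.
Proof. by move=> u1; rewrite !dotp_lincomb u1; ring. Qed.

Lemma mirror_swap x y : dotp x x = dotp y y -> eudist x y != 0 ->
  let u := lincomb (eudist x y)^-1 x (- (eudist x y)^-1) y in
  dotp u u = 1 /\ mirror u x = y.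
Proof.
move=> xy d0 /=.
have d2 := sqr_eudist x y.
have xyE : dotp x y = dotp y y - eudist x y ^+ 2 / 2.
  by rewrite d2 xy; field.
split; first by rewrite !dotp_lincomb (dotpC y x) xyE xy; field.
apply: eq_from_tnth => i; rewrite !tnth_lincomb !dotp_lincomb xyE xy.
by field.
Qed.

End TupleGeometry.

(** * Lebesgue measure on tuples *)

Section MeasurePacking.
Context d1 d2 (X : measurableType d1) (Y : measurableType d2) (R : realType).

Lemma pushforward_measure_exists (phi : X -> Y)
    (mu : {measure set X -> \bar R}) : measurable_fun setT phi ->
  exists nu : {measure set Y -> \bar R}, forall A, nu A = mu (phi @^-1` A).
Proof.
move=> mphi; unshelve eexists.
  by unshelve refine (pushforward mu phi : {measure set Y -> \bar R}).
by [].
Qed.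

Lemma sigma_finite_measure_exists (nu : {measure set Y -> \bar R}) :
  sigma_finite setT nu ->
  exists nu' : {sigma_finite_measure set Y -> \bar R}, forall A, nu' A = nu A.
Proof.
move=> h; unshelve eexists.
  pose H1 := isSigmaFinite.Build _ _ _ _ h.
  pose H2 := isSFinite.Build _ _ _ _ (sfinite_measure_sigma_finite h).
  exact: (HB.pack_for {sigma_finite_measure set Y -> \bar R}
    (Measure.sort nu) H1 H2).
by [].
Qed.

Lemma integral_image_measure (phi : X -> Y) (mu : {measure set X -> \bar R})
    (nu : {measure set Y -> \bar R}) f : measurable_fun setT phi ->
  (forall A, measurable A -> nu A = mu (phi @^-1` A)) ->
  measurable_fun setT f -> (forall y, 0 <= f y)%E ->
  (\int[nu]_y f y = \int[mu]_x f (phi x))%E.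
Proof.
move=> mphi h mf f0.
rewrite -[RHS](@ge0_integral_pushforward _ _ _ _ _ _ mphi mu setT f)//.
by apply: eq_measure_integral => A mA _; exact: h.
Qed.

End MeasurePacking.

Section LebesgueTranslation.
Context {R : realType}.
Local Notation leb := (@lebesgue_measure R).

Lemma measurable_addr (a : R) :
  measurable_fun setT ((fun x : measurableTypeR R => x + a) :
    measurableTypeR R -> measurableTypeR R).
Proof. exact: measurable_funD. Qed.

Lemma lebesgue_measure_translate (a : R) (A : set (measurableTypeR R)) :
  measurable A -> leb ((fun x => x + a) @^-1` A) = leb A.
Proof.
have [nu nuE] := @pushforward_measure_exists _ _ _ _ _ _ leb (measurable_addr a).
move=> mA; rewrite -nuE; apply/esym/lebesgue_measure_unique => //= _ [[b c]] _ <-.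
rewrite nuE (_ : _ @^-1` _ = `](b - a), (c - a)]%classic); last first.
  by apply/seteqP; split=> x /=; rewrite !in_itv/= ltrBlDr lerBrDr.
rewrite lebesgue_measure_itv/= (lebesgue_measure_itv `](b - a), (c - a)])/=.
rewrite !lte_fin ltrD2r -!EFinB.
by congr (if _ then _%:E else _); ring.
Qed.

Lemma integral_translate (a : R) (f : measurableTypeR R -> \bar R) :
  measurable_fun setT f -> (forall x, 0 <= f x)%E ->
  (\int[leb]_x f (x + a)%R = \int[leb]_x f x)%E.
Proof.
move=> mf f0.
apply: esym.
apply: (@integral_image_measure _ _ _ _ _ _ leb leb f (measurable_addr a)) => // A mA.
by apply/esym/lebesgue_measure_translate.
Qed.

End LebesgueTranslation.

Section TupleLebesgue.
Context {R : realType}.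
Local Notation leb := (@lebesgue_measure R).

Definition is_lebesgue n (lam : set (n.-tuple R) -> \bar R) :=
  forall f : n.-tuple R -> \bar R, measurable_fun setT f ->
    (forall x, 0 <= f x)%E -> iint f = (\int[lam]_x f x)%E.

Definition box n (r : R) : set (n.-tuple R) :=
  [set x | forall i, `|tnth x i| <= r].
Arguments box n r : clear implicits.

Definition tcons n (p : measurableTypeR R * n.-tuple R) : n.+1.-tuple R :=
  [tuple of p.1 :: p.2].

Lemma measurable_tcons n : measurable_fun setT (@tcons n).
Proof. exact: measurable_cons. Qed.

Lemma measurable_box n r : measurable (box n r).
Proof.
rewrite (_ : box n r =
    \bigcap_(i in [set: 'I_n]) ((fun x => tnth x i) @^-1` `[-r, r]%classic)).
  apply: fin_bigcap_measurable => // i _; rewrite -[X in measurable X]setTI.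
  exact: measurable_tnth.
apply/seteqP; split=> x /= h i.
  by move=> _ /=; rewrite in_itv/= -ler_norml.
by have := h i I; rewrite /= in_itv/= -ler_norml.
Qed.

Lemma measurable_iint_cons n
    (lam : {sigma_finite_measure set (n.-tuple R) -> \bar R})
    (f : n.+1.-tuple R -> \bar R) :
  is_lebesgue lam -> measurable_fun setT f -> (forall x, 0 <= f x)%E ->
  measurable_fun setT
    (fun t : measurableTypeR R => iint (fun y => f (tcons (t, y)))) /\
  iint f = (\int[leb \x lam]_p f (tcons p))%E.
Proof.
move=> hlam mf f0.
have mfc : measurable_fun setT (f \o @tcons n).
  by apply: measurableT_comp => //; exact: measurable_tcons.
have E : (fun t : measurableTypeR R => iint (fun y => f (tcons (t, y)))) =
   fubini_F lam (f \o @tcons n).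
  apply/funext => t; rewrite hlam//.
  apply: (measurable_fun_pair2 (f := f \o @tcons n)) => //.
split.
  by rewrite E; apply: measurable_fun_fubini_tonelli_F => // p; exact: f0.
transitivity (\int[leb]_t fubini_F lam (f \o @tcons n) t)%E.
  by apply: eq_integral => t _; rewrite -E.
by apply: esym; apply: (@fubini_tonelli1 _ _ _ _ _ leb lam _ mfc) => p; exact: f0.
Qed.


Lemma iint_eq n (f g : n.-tuple R -> \bar R) : f =1 g -> iint f = iint g.
Proof. by move=> /funext ->. Qed.

Lemma iint0 n : iint (fun _ : n.-tuple R => 0%E) = 0%E :> \bar R.
Proof.
elim: n => [|n IH] //=.
by under eq_integral do rewrite IH; exact: integral0.
Qed.

Lemma tnth_tcons0 n (t : R) (y : n.-tuple R) : tnth (tcons (t, y)) ord0 = t.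
Proof. exact: tnth0. Qed.

Lemma tnth_tconsS n (t : R) (y : n.-tuple R) i :
  tnth (tcons (t, y)) (lift ord0 i) = tnth y i.
Proof. exact: tnthS. Qed.

Lemma box_tcons n (r t : R) (y : n.-tuple R) :
  box n.+1 r (tcons (t, y)) <-> `|t| <= r /\ box n r y.
Proof.
split=> [h|[h1 h2] i].
  split; first by have := h ord0; rewrite tnth_tcons0.
  by move=> i; have := h (lift ord0 i); rewrite tnth_tconsS.
by case: (unliftP ord0 i) => [j ->|->]; rewrite ?tnth_tcons0 ?tnth_tconsS.
Qed.

Lemma iint_box n (r : R) : 0 <= r ->
  iint (fun x : n.-tuple R => (\1_(box n r) x)%:E) = ((2 * r) ^+ n)%:E.
Proof.
move=> r0; elim: n => [|n IH].
  by rewrite /= expr0 indicE mem_set// => i; case: i.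
rewrite /=.
transitivity (\int[leb]_t (((2 * r) ^+ n)%:E * (\1_(`[-r, r]%classic) t)%:E))%E.
  apply: eq_integral => t _.
  rewrite [in RHS]indicE.
  have [|] := boolP (t \in `[-r, r]%classic); rewrite ?notin_setE ?inE => ht.
    rewrite mule1 -IH; apply: iint_eq => y; rewrite !indicE; congr (_%:R%:E).
    congr (nat_of_bool _); apply/idP/idP; rewrite !inE => h.
      by have [] := (box_tcons r t y).1 h.
    apply: (box_tcons r t y).2; split => //.
    by move: ht; rewrite /= in_itv/= ler_norml.
  rewrite mule0 -[RHS](@iint0 n); apply: iint_eq => y; rewrite indicE.
  rewrite memNset// => h; apply: ht; have [+ _] := (box_tcons r t y).1 h.
  by rewrite /= in_itv/= ler_norml.
have li : leb (`[-r, r]%classic : set R) = (2 * r)%:E.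
  rewrite lebesgue_measure_itv/= lte_fin.
  case: ifPn => h; first by rewrite -EFinB; congr EFin; ring.
  by rewrite (_ : r = 0) ?mulr0//; move: h; rewrite -leNgt; lra.
rewrite ge0_integralZl//.
  rewrite integral_indic// setIT -[X in (_ * X)%E]/(leb `[-r, r]%classic) li.
    by rewrite exprSr EFinM.
  apply/measurable_EFinP; apply: measurable_indic; exact: measurable_itv.
by rewrite lee_fin exprn_ge0// mulr_ge0.
Qed.

Lemma lebesgue_box n (lam : {measure set (n.-tuple R) -> \bar R}) (r : R) :
  is_lebesgue lam -> 0 <= r -> lam (box n r) = ((2 * r) ^+ n)%:E.
Proof.
move=> hlam r0; rewrite -(iint_box n r0) hlam.
- by rewrite integral_indic ?setIT//; exact: (@measurable_box n r).
- by apply/measurable_EFinP; apply: measurable_indic; exact: measurable_box.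
- by move=> x; rewrite lee_fin.
Qed.

Lemma bigcup_box n : \bigcup_k box n k%:R = [set: n.-tuple R].
Proof.
apply/seteqP; split=> // x _.
have [k hk] : exists k, forall i, `|tnth x i| <= k%:R.
  have h0 : 0 <= \sum_i `|tnth x i| by apply: sumr_ge0.
  exists (Num.truncn (\sum_i `|tnth x i|)).+1 => i.
  apply: le_trans (ltW (truncnS_gt _)).
  by rewrite (bigD1 i)//= lerDl; apply: sumr_ge0.
by exists k.
Qed.

Lemma lebesgue_tuple_exists n :
  exists lam : {sigma_finite_measure set (n.-tuple R) -> \bar R},
    is_lebesgue lam.
Proof.
elim: n => [|n [lam hlam]].
  exists (dirac ([tuple] : 0.-tuple R)) => f mf f0.
  by rewrite integral_dirac// diracT mul1e.
have [nu nuE] := @pushforward_measure_exists _ _ _ _ _ _ (leb \x lam)%E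
  (@measurable_tcons n).
have nuL : is_lebesgue nu.
  move=> f mf f0; have [_ ->] := measurable_iint_cons hlam mf f0.
  apply: esym; apply: (integral_image_measure (@measurable_tcons n)) => // A mA.
have [|nu' nu'E] := @sigma_finite_measure_exists _ _ _ nu.
  exists (fun k => box n.+1 k%:R); first by rewrite bigcup_box.
  move=> k; split; first exact: measurable_box.
  by rewrite lebesgue_box// ltry.
exists nu' => f mf f0; rewrite nuL//.
by apply: eq_measure_integral => A _ _; exact/esym/nu'E.
Qed.

Lemma measurable_lincomb n a b :
  measurable_fun setT (fun p : n.-tuple R * n.-tuple R => lincomb a p.1 b p.2).
Proof.
apply/measurable_fun_tnthP => i.
rewrite (_ : _ \o _ = fun p : n.-tuple R * n.-tuple R =>
  a * tnth p.1 i + b * tnth p.2 i); last first.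
  by apply/funext => p /=; rewrite tnth_lincomb.
apply: measurable_funD; apply: measurable_funM => //.
- apply: (@measurableT_comp _ _ _ _ _ _ (fun x => tnth x i)) => //.
  exact: measurable_tnth.
- apply: (@measurableT_comp _ _ _ _ _ _ (fun x => tnth x i)) => //.
  exact: measurable_tnth.
Qed.

Lemma measurable_lincomb_fun d (X : measurableType d) n a b
    (f g : X -> n.-tuple R) : measurable_fun setT f -> measurable_fun setT g ->
  measurable_fun setT (fun x => lincomb a (f x) b (g x)).
Proof.
move=> mf mg; apply: (@measurableT_comp _ _ _ _ _ _
  (fun p : n.-tuple R * n.-tuple R => lincomb a p.1 b p.2) _
  (fun x => (f x, g x))); first exact: measurable_lincomb.
exact: measurable_fun_pair.
Qed.

Lemma iint_translate n a (f : n.-tuple R -> \bar R) :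
  measurable_fun setT f -> (forall x, 0 <= f x)%E ->
  iint (fun x => f (lincomb 1 x 1 a)) = iint f.
Proof.
elim: n a f => [|n IH] a f mf f0; first by congr f; exact: tuple0.
have [lam hlam] := lebesgue_tuple_exists n.
have [mg _] := measurable_iint_cons hlam mf f0.
transitivity (\int[leb]_t
    (fun t => iint (fun y => f (tcons (t, y)))) (t + tnth a ord0)%R)%E.
  apply: eq_integral => t _ /=.
  rewrite -[RHS](IH [tuple of behead a]).
  - apply: iint_eq => y; congr f; apply: eq_from_tnth => i.
    case: (unliftP ord0 i) => [j ->|->].
      rewrite tnth_lincomb !tnth_tconsS tnth_lincomb tnth_behead.
      by congr (_ + _ * tnth a _); apply/val_inj; rewrite /= inordK ?ltnS.
    by rewrite tnth_lincomb !tnth_tcons0 !mul1r.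
  - apply: (measurable_fun_pair2 (f := f \o @tcons n)).
    by apply: measurableT_comp => //; exact: measurable_tcons.
  - by move=> y; exact: f0.
apply: (integral_translate (tnth a ord0) mg) => t.
have mft : measurable_fun setT (fun y : n.-tuple R => f (tcons (t, y))).
  apply: (measurable_fun_pair2 (f := f \o @tcons n)).
  by apply: measurableT_comp => //; exact: measurable_tcons.
by rewrite hlam//; apply: integral_ge0 => y _; exact: f0.
Qed.

End TupleLebesgue.
Arguments box {R} n r.

(** * Invariance under reflections *)

Section Invariance.
Context {R : realType}.

Lemma measurable_preimage d1 d2 (X : measurableType d1) (Y : measurableType d2)
    (f : X -> Y) B : measurable_fun setT f -> measurable B ->
  measurable (f @^-1` B).
Proof. by move=> mf mB; rewrite -[X in measurable X]setTI; exact: mf. Qed.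

Lemma measurable_dotp d (X : measurableType d) n (f g : X -> n.-tuple R) :
  measurable_fun setT f -> measurable_fun setT g ->
  measurable_fun setT (fun x => dotp (f x) (g x)).
Proof.
move=> mf mg; apply: measurable_sum => i; apply: measurable_funM.
- apply: (@measurableT_comp _ _ _ _ _ _ (fun x => tnth x i)) => //.
  exact: measurable_tnth.
- apply: (@measurableT_comp _ _ _ _ _ _ (fun x => tnth x i)) => //.
  exact: measurable_tnth.
Qed.

Lemma measurable_enorm d (X : measurableType d) n (f : X -> n.-tuple R) :
  measurable_fun setT f -> measurable_fun setT (fun x => enorm (f x)).
Proof.
move=> mf; apply: (@measurableT_comp _ _ _ _ _ _ (@Num.sqrt R)).
  by apply: continuous_measurable_fun; exact: sqrt_continuous.
exact: measurable_dotp.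
Qed.

Lemma measurable_mirror n (u : n.-tuple R) : measurable_fun setT (mirror u).
Proof.
apply/measurable_fun_tnthP => i.
rewrite (_ : _ \o _ = fun x : n.-tuple R =>
  tnth x i + (- 2 * dotp x u) * tnth u i); last first.
  by apply/funext => p /=; rewrite tnth_lincomb mul1r.
apply: measurable_funD; first exact: measurable_tnth.
apply: measurable_funM => //; apply: measurable_funM => //.
exact: measurable_dotp.
Qed.

Definition translation_invariant n (mu : set (n.-tuple R) -> \bar R) :=
  forall a B, measurable B -> mu ((fun x => lincomb 1 x 1 a) @^-1` B) = mu B.

Definition eball n (r : R) : set (n.-tuple R) := [set x | enorm x <= r].
Arguments eball n r : clear implicits.

Lemma measurable_eball n r : measurable (eball n r).
Proof.
have -> : eball n r = @enorm R n @^-1` `]-oo, r]%classic.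
  by apply/seteqP; split => x /=; rewrite in_itv.
by apply: measurable_preimage; [exact: measurable_enorm|exact: measurable_itv].
Qed.

Lemma translation_invariant_unique n
    (lam nu : {sigma_finite_measure set (n.-tuple R) -> \bar R})
    (E F : set (n.-tuple R)) :
  translation_invariant lam -> translation_invariant nu ->
  measurable E -> measurable F ->
  (forall x, F (lincomb (-1) x 0 x) <-> F x) ->
  (lam E * nu F = lam F * nu E)%E.
Proof.
move=> tlam tnu mE mF Fsym.
pose G := [set p : n.-tuple R * n.-tuple R | F p.2 /\ E (lincomb 1 p.1 1 p.2)].
pose H := [set p : n.-tuple R * n.-tuple R | E p.2 /\ F (lincomb (-1) p.1 1 p.2)].
have mS (A B : set (n.-tuple R)) c : measurable A -> measurable B ->
    measurable [set p : n.-tuple R * n.-tuple R |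
      A p.2 /\ B (lincomb c p.1 1 p.2)].
  move=> mA mB; apply: measurableI.
    by apply: (measurable_preimage (f := snd)) => //; exact: measurable_snd.
  by apply: (measurable_preimage (f := fun p => lincomb c p.1 1 p.2)) => //;
    exact: measurable_lincomb.
have mG : measurable G by exact: mS.
have mH : measurable H by exact: mS.
have fub (A : set (n.-tuple R * n.-tuple R)) : measurable A ->
    (\int[lam]_x nu (xsection A x) = \int[nu]_y lam (ysection A y))%E.
  move=> mA; have := indic_fubini_tonelli lam nu mA.
  by rewrite indic_fubini_tonelli_FE// indic_fubini_tonelli_GE.
have cst1 (mu mu' : {sigma_finite_measure set (n.-tuple R) -> \bar R})
    (A : set (n.-tuple R)) c : measurable A ->
    (0 <= c)%E -> (\int[mu]_y (c * (\1_A y)%:E) = c * mu A)%E.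
  move=> mA c0; rewrite ge0_integralZl//.
    by rewrite integral_indic// setIT.
  by apply/measurable_EFinP; exact: measurable_indic.
have L : (\int[nu]_y lam (ysection G y) = lam E * nu F)%E.
  rewrite -(cst1 nu lam)//; apply: eq_integral => y _.
  rewrite indicE; have [|] := boolP (y \in F); rewrite ?notin_setE ?inE => yF.
    rewrite mule1 -(tlam y E mE); congr (lam _); apply/seteqP; split => x.
      by rewrite /ysection /= inE /G/= => -[].
    by rewrite /ysection /= inE /G/= => ?; split.
  rewrite mule0 (_ : ysection _ _ = set0) ?measure0//.
  by apply/seteqP; split => x //; rewrite /ysection /= inE /G/= => -[].
have M : (\int[nu]_y lam (ysection H y) = lam F * nu E)%E.
  rewrite -(cst1 nu lam)//; apply: eq_integral => z _.
  rewrite indicE; have [|] := boolP (z \in E); rewrite ?notin_setE ?inE => zE.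
    rewrite mule1 -(tlam (lincomb (-1) z 0 z) F mF); congr (lam _).
    apply/seteqP; split => x; rewrite /ysection /= inE /H/=.
      move=> [_ /Fsym]; congr F; apply: eq_from_tnth => i.
      by rewrite !tnth_lincomb; ring.
    move=> h; split => //; apply/Fsym; move: h; congr F.
    by apply: eq_from_tnth => i; rewrite !tnth_lincomb; ring.
  rewrite mule0 (_ : ysection _ _ = set0) ?measure0//.
  by apply/seteqP; split => x //; rewrite /ysection /= inE /H/= => -[].
rewrite -L -M -!fub//; apply: eq_integral => x _.
rewrite -(tnu x (xsection H x)); last exact: measurable_xsection.
congr (nu _); apply/seteqP; split => y; rewrite /xsection /= !inE /G /H/=.
  move=> [yF E1]; split; first by move: E1; congr E; apply: eq_from_tnth => i;
    rewrite !tnth_lincomb; ring.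
  by move: yF; congr F; apply: eq_from_tnth => i; rewrite !tnth_lincomb; ring.
move=> [E1 yF]; split; last by move: E1; congr E; apply: eq_from_tnth => i;
  rewrite !tnth_lincomb; ring.
by move: yF; congr F; apply: eq_from_tnth => i; rewrite !tnth_lincomb; ring.
Qed.


Lemma lebesgue_iint n (lam : {measure set (n.-tuple R) -> \bar R}) B :
  is_lebesgue lam -> measurable B -> lam B = iint (fun x => (\1_B x)%:E).
Proof.
move=> hlam mB; rewrite hlam.
- by rewrite integral_indic// setIT.
- by apply/measurable_EFinP; exact: measurable_indic.
- by move=> x; rewrite lee_fin.
Qed.

Lemma lebesgue_translation_invariant n
    (lam : {measure set (n.-tuple R) -> \bar R}) :
  is_lebesgue lam -> translation_invariant lam.
Proof.
move=> hlam a B mB.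
have ml : measurable_fun setT (fun x : n.-tuple R => lincomb 1 x 1 a).
  by apply: measurable_lincomb_fun; [exact: measurable_id|exact: measurable_cst].
rewrite !(lebesgue_iint hlam)//; last exact: measurable_preimage.
have mi : measurable_fun setT (fun x => (\1_B x : R)%:E).
  by apply/measurable_EFinP; exact: measurable_indic.
by rewrite -[RHS](iint_translate a mi)// => x; rewrite lee_fin.
Qed.

Section LebesgueMeasure.
Context {n : nat} (lam : {sigma_finite_measure set (n.-tuple R) -> \bar R}).
Hypothesis hlam : is_lebesgue lam.

Lemma eball_sub_box r : eball n r `<=` box n r.
Proof.
move=> x /= xr i; apply: le_trans xr.
rewrite -ler_sqr ?nnegrE ?enorm_ge0// real_normK ?num_real// sqr_enorm.
exact: sqr_tnth_le.
Qed.

Lemma box_sub_eball r : 0 <= r -> box n (r / n.+1%:R) `<=` eball n r.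
Proof.
move=> r0 x /= h; rewrite /eball/= -ler_sqr ?nnegrE ?enorm_ge0// sqr_enorm.
apply: (@le_trans _ _ (\sum_(i < n) (r / n.+1%:R) ^+ 2)).
  apply: ler_sum => i _; rewrite -expr2 -[X in X <= _]real_normK ?num_real//.
  by rewrite ler_sqr ?nnegrE// divr_ge0.
rewrite sumr_const card_ord -[X in X <= _]mulr_natl expr_div_n mulrCA ler_piMr ?sqr_ge0//.
rewrite ler_pdivrMr ?exprn_gt0// mul1r -natrX ler_nat.
by apply: leq_trans (leqnSn n) _; rewrite expnS leq_pmulr.
Qed.

Lemma lebesgue_eball_lty r : 0 <= r -> (lam (eball n r) < +oo)%E.
Proof.
move=> r0; apply: (@le_lt_trans _ _ (lam (box n r))).
  apply: le_measure; rewrite ?inE; [exact: measurable_eball|exact: measurable_box|].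
  exact: eball_sub_box.
by rewrite lebesgue_box// ltry.
Qed.

Lemma lebesgue_eball_gt0 r : 0 < r -> (0 < lam (eball n r))%E.
Proof.
move=> r0; apply: (@lt_le_trans _ _ (lam (box n (r / n.+1%:R)))).
  by rewrite lebesgue_box ?lte_fin ?exprn_gt0 ?mulr_gt0 ?divr_gt0// divr_ge0// ltW.
apply: le_measure; rewrite ?inE; [exact: measurable_box|exact: measurable_eball|].
exact/box_sub_eball/ltW.
Qed.

Lemma bigcup_eball : \bigcup_k eball n k%:R = [set: n.-tuple R].
Proof.
apply/seteqP; split=> // x _; exists (Num.truncn (enorm x)).+1 => //.
by rewrite /eball/= ltW// truncnS_gt.
Qed.

Lemma eball_sym r x : eball n r (lincomb (-1) x 0 x) <-> eball n r x.
Proof.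
rewrite /eball/= (_ : enorm (lincomb _ _ _ _) = enorm x)//.
by rewrite /enorm !dotp_lincomb; congr Num.sqrt; ring.
Qed.

(* The image measure is again translation invariant, and gives the same mass
   to the unit ball. *)
Lemma lebesgue_mirror u E : dotp u u = 1 -> measurable E ->
  lam (mirror u @^-1` E) = lam E.
Proof.
move=> u1 mE; have mm := @measurable_mirror n u.
have [nu0 nu0E] := @pushforward_measure_exists _ _ _ _ _ _ lam mm.
have nub r : nu0 (eball n r) = lam (eball n r).
  rewrite nu0E; congr (lam _); apply/seteqP.
  by split=> x; rewrite /eball/= enorm_mirror.
have [|nu nuE] := @sigma_finite_measure_exists _ _ _ nu0.
  exists (fun k => eball n k%:R); first by rewrite bigcup_eball.
  by move=> k; split; [exact: measurable_eball|rewrite nub lebesgue_eball_lty].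
have tnu : translation_invariant nu.
  move=> a B mB; rewrite !nuE !nu0E.
  rewrite -[RHS](@lebesgue_translation_invariant _ _ hlam (mirror u a))//.
    congr (lam _); apply/seteqP; split=> x /=; congr B; apply: eq_from_tnth => i;
    rewrite !tnth_lincomb !dotp_lincomb u1; ring.
  exact: measurable_preimage.
have := @translation_invariant_unique _ lam nu E (eball n 1)
  (lebesgue_translation_invariant hlam) tnu mE (@measurable_eball n 1)
  (eball_sym 1).
rewrite !nuE nub nu0E => h.
have fin : lam (eball n 1) \is a fin_num.
  by rewrite ge0_fin_numE ?lebesgue_eball_lty.
have neq0 : lam (eball n 1) != 0%E by rewrite gt_eqF ?lebesgue_eball_gt0.
move: h; rewrite muleC => /(congr1 (fun z => (lam (eball n 1))^-1 * z)%E).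
by rewrite !muleA mulVe// !mul1e.
Qed.

Lemma lebesgue_eball_scale r : 0 < r ->
  lam (eball n r) = ((r ^+ n)%:E * lam (eball n 1))%E.
Proof.
move=> r0; pose s (x : n.-tuple R) := lincomb r^-1 x 0 x.
have ms : measurable_fun setT s by exact: measurable_lincomb_fun.
have [nu0 nu0E] := @pushforward_measure_exists _ _ _ _ _ _ lam ms.
have nubox k : 0 <= k -> nu0 (box n k) = ((2 * r * k) ^+ n)%:E.
  move=> k0; rewrite nu0E -(_ : box n (r * k) = s @^-1` box n k); last first.
    apply/seteqP; split=> x h i; have := h i;
    by rewrite /s tnth_lincomb mul0r addr0 normrM gtr0_norm ?invr_gt0//
      ler_pdivrMl.
  have rk : 0 <= r * k by rewrite mulr_ge0// ltW.
  by rewrite (lebesgue_box hlam rk) mulrA.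
have nub : nu0 (eball n 1) = lam (eball n r).
  have se x : enorm (s x) = r^-1 * enorm x.
    rewrite /enorm (_ : dotp (s x) (s x) = r^-1 ^+ 2 * dotp x x).
      by rewrite sqrtrM ?sqr_ge0// sqrtr_sqr gtr0_norm ?invr_gt0.
    by rewrite !dotp_lincomb; ring.
  rewrite nu0E; congr (lam _); apply/seteqP.
  by split=> x; rewrite /eball/= se ler_pdivrMl ?mulr1.
have [|nu nuE] := @sigma_finite_measure_exists _ _ _ nu0.
  exists (fun k => box n k%:R); first by rewrite bigcup_box.
  by move=> k; split; [exact: measurable_box|rewrite nubox ?ltry].
have tnu : translation_invariant nu.
  move=> a B mB; rewrite !nuE !nu0E.
  rewrite -[RHS](@lebesgue_translation_invariant _ _ hlam (lincomb r a 0 a))//.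
    congr (lam _); apply/seteqP; split=> x /=; congr B; apply: eq_from_tnth => i;
    rewrite !tnth_lincomb; field; exact: lt0r_neq0.
  exact: measurable_preimage.
have := @translation_invariant_unique _ lam nu (box n 1) (eball n 1)
  (lebesgue_translation_invariant hlam) tnu (@measurable_box R n 1)
  (@measurable_eball n 1) (eball_sym 1).
rewrite !nuE nub nubox// lebesgue_box//.
rewrite !mulr1 exprMn EFinM => h.
move: h; rewrite muleC [RHS]muleC -muleA.
move=> /(congr1 (fun z => (((2:R) ^+ n)%:E)^-1 * z)%E).
by rewrite [X in (_ * X = _)%E -> _]muleC !muleA mulVe ?mul1e// eqe gt_eqF// exprn_gt0.
Qed.

End LebesgueMeasure.
End Invariance.
Arguments eball {R} n r.

(** * The cone measure of the sphere *)

Section ConeMeasure.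
Context {R : realType} {n : nat}.
Implicit Types (mu : {finite_measure set (n.-tuple R) -> \bar R})
  (B : set (n.-tuple R)).

Definition is_cone_measure (mu : set (n.-tuple R) -> \bar R) :=
  forall B, measurable B -> mu B = iint (fun x => (\1_(cone B) x)%:E).

Lemma measurable_normalize : measurable_fun setT (@normalize R n).
Proof.
apply/measurable_fun_tnthP => i.
rewrite (_ : _ \o _ = fun x : n.-tuple R => tnth x i * (enorm x) `^ (-1)).
  apply: measurable_funM; first exact: measurable_tnth.
  apply: (@measurableT_comp _ _ _ _ _ _ (@powR R ^~ (-1))).
    exact: measurable_powR.
  exact: measurable_enorm.
by apply/funext => p /=; rewrite tnth_map powR_inv1// enorm_ge0.
Qed.

Lemma measurable_punctured_ball :
  measurable [set x : n.-tuple R | 0 < enorm x <= 1].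
Proof.
rewrite (_ : mkset _ = @enorm R n @^-1` `]0, 1]%classic).
  by apply: measurable_preimage; [exact: measurable_enorm|exact: measurable_itv].
by apply/seteqP; split => x /=; rewrite in_itv.
Qed.

Lemma measurable_usphere : measurable (@usphere R n).
Proof.
rewrite (_ : usphere n = @enorm R n @^-1` [set 1]) //.
by apply: measurable_preimage; [exact: measurable_enorm|exact: measurable_set1].
Qed.

Lemma coneE B :
  cone B = (@normalize R n @^-1` B) `&` [set x : n.-tuple R | 0 < enorm x <= 1].
Proof. by apply/seteqP; split => x [? ?]; split. Qed.

Lemma measurable_cone B : measurable B -> measurable (cone B).
Proof.
move=> mB; rewrite coneE; apply: measurableI; last exact: measurable_punctured_ball.
by apply: measurable_preimage => //; exact: measurable_normalize.
Qed.

Lemma enorm_normalize (x : n.-tuple R) : 0 < enorm x -> enorm (normalize x) = 1.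
Proof.
move=> x0; have -> : normalize x = lincomb (enorm x)^-1 x 0 x.
  by apply: eq_from_tnth => i; rewrite tnth_lincomb tnth_map mul0r addr0 mulrC.
apply/usphereP; rewrite !dotp_lincomb -!sqr_enorm.
by field; exact: lt0r_neq0.
Qed.

Lemma mirror_normalize (u x : n.-tuple R) : dotp u u = 1 ->
  normalize (mirror u x) = mirror u (normalize x).
Proof.
move=> u1; apply: eq_from_tnth => i.
rewrite tnth_map !tnth_lincomb enorm_mirror// !tnth_map.
rewrite (_ : dotp (normalize x) u = dotp x u / enorm x); first by ring.
rewrite /dotp mulr_suml; apply: eq_bigr => j _.
by rewrite tnth_map mulrAC.
Qed.

Lemma integral_mrestr d (T : measurableType d) (D : set T)
    (mD : measurable D) (lam : {measure set T -> \bar R}) f :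
  measurable_fun setT f -> (forall x, 0 <= f x)%E ->
  (\int[mrestr lam mD]_x f x = \int[lam]_(x in D) f x)%E.
Proof.
move=> mf f0; rewrite -(setUv D) ge0_integral_setU//=.
- rewrite (eq_measure_integral lam); last first.
    by move=> A mA AD; rewrite /= /mrestr setIidl.
  rewrite [X in (_ + X)%E]null_set_integral ?adde0//.
  + exact: measurableC.
  + exact: measurable_funTS.
  + by rewrite /= /mrestr setICl measure0.
- exact: measurableC.
- by rewrite setUv.
- by apply/disj_setPS; rewrite setICr.
Qed.

Lemma cone_measure_exists :
  exists mu, is_cone_measure mu /\
  forall B (g : n.-tuple R -> R), measurable B -> B `<=` usphere n ->
    measurable_fun B g -> (forall x, B x -> 0 <= g x) ->
    iint (fun x => (\1_(cone B) x * g (normalize x))%:E) =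
    (\int[mu]_(x in B) (g x)%:E)%E.
Proof.
have [lam hlam] := @lebesgue_tuple_exists R n.
have mP := measurable_punctured_ball.
have [mu muE] := @pushforward_measure_exists _ _ _ _ _ _
  (mrestr lam mP) measurable_normalize.
have muc B : measurable B -> mu B = lam (cone B).
  by move=> mB; rewrite muE /mrestr coneE.
have fmu : fin_num_fun mu.
  move=> B mB; rewrite ge0_fin_numE// muc//.
  apply: le_lt_trans (lebesgue_eball_lty hlam ler01).
  apply: le_measure; rewrite ?inE; [exact: measurable_cone|exact: measurable_eball|].
  by move=> x [/andP[]].
pose H1 := isFinite.Build _ _ _ _ fmu.
have smu : sigma_finite setT mu.
  by apply: fin_num_fun_sigma_finite => //; rewrite measure0.
pose H2 := isSFinite.Build _ _ _ _ (sfinite_measure_sigma_finite smu).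
pose H3 := isSigmaFinite.Build _ _ _ _ smu.
pose mu' : {finite_measure set (n.-tuple R) -> \bar R} :=
  HB.pack_for {finite_measure set (n.-tuple R) -> \bar R}
    (Measure.sort mu) H1 H2 H3.
exists mu'; split.
  move=> B mB; rewrite /mu' /= muc// (lebesgue_iint hlam)//.
  exact: measurable_cone.
move=> B g mB BS mg g0.
rewrite /mu' /=.
pose G := (fun x => (g x)%:E) \_ B.
have mG : measurable_fun setT G.
  have mgE : measurable_fun B (fun x => (g x)%:E).
    by apply/measurable_EFinP; exact: mg.
  exact: (measurable_restrictT _ mB).1 mgE.
have G0 x : (0 <= G x)%E.
  by rewrite /G patchE; case: ifPn => //; rewrite inE lee_fin => /g0.
rewrite [RHS]integral_mkcond -/G.
rewrite (integral_image_measure measurable_normalize (mu := mrestr lam mP))//.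
  rewrite integral_mrestr//; last first.
    by apply: measurableT_comp => //; exact: measurable_normalize.
  rewrite integral_mkcond -hlam.
    apply: iint_eq => x; rewrite patchE indicE /G patchE coneE in_setI.
    have -> : (x \in normalize (n:=n) @^-1` B) = (normalize x \in B).
      by apply/idP/idP; rewrite !inE.
    by case: (normalize x \in B); case: (x \in _);
      rewrite /= ?mul1r ?mul0r.
  have mGn : measurable_fun setT (G \o @normalize R n).
    by apply: measurableT_comp => //; exact: measurable_normalize.
  apply: (measurable_restrictT _ mP).1; exact: measurable_funTS.
by move=> x; rewrite patchE; case: ifPn => // _; exact: G0.
Qed.

End ConeMeasure.

Section ConeMeasureTheory.
Context {R : realType} {n : nat} (mu : {finite_measure set (n.-tuple R) -> \bar R}).
Hypothesis hmu : is_cone_measure mu.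

Lemma measurable_eudist (x : n.-tuple R) : measurable_fun setT (eudist x).
Proof.
apply: (measurable_enorm (f := fun y => lincomb 1 x (-1) y)).
apply: (measurable_lincomb_fun 1 (-1) (f := cst x) (g := id)).
  exact: measurable_cst.
exact: measurable_id.
Qed.

Lemma measurable_eudist_ball (x : n.-tuple R) r :
  measurable [set y | eudist x y < r].
Proof.
rewrite (_ : mkset _ = eudist x @^-1` `]-oo, r[%classic).
  by apply: measurable_preimage; [exact: measurable_eudist|exact: measurable_itv].
by apply/seteqP; split => y /=; rewrite in_itv.
Qed.

Lemma cone_measure_off_sphere : mu (~` usphere n) = 0%E.
Proof.
rewrite hmu; last by apply: measurableC; exact: measurable_usphere.
rewrite -[RHS](@iint0 R n); apply: iint_eq => x; rewrite indicE memNset// => -[].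
by move=> /andP[x0 _]; apply; exact: enorm_normalize.
Qed.

Lemma cone_measure_mirror u B : dotp u u = 1 -> measurable B ->
  mu (mirror u @^-1` B) = mu B.
Proof.
move=> u1 mB; have [lam hlam] := @lebesgue_tuple_exists R n.
have mm := @measurable_mirror R n u.
rewrite !hmu//; last exact: measurable_preimage.
rewrite -!(lebesgue_iint hlam); last 2 first.
- exact: measurable_cone.
- by apply: measurable_cone; exact: measurable_preimage.
rewrite -[RHS](lebesgue_mirror hlam u1); last exact: measurable_cone.
congr (lam _); apply/seteqP; split => x; rewrite /cone/= enorm_mirror//;
by rewrite mirror_normalize.
Qed.

(* Around [x] on the sphere, the cone over the ball of radius [r] contains the
   ball of radius [min (r / 8) (1 / 4)] around the midpoint of [0] and [x]. *)
Lemma cone_measure_ball_gt0 (x : n.-tuple R) r : usphere n x -> 0 < r ->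
  (0 < mu [set y | eudist x y < r]%R)%E.
Proof.
move=> xS r0; have [lam hlam] := @lebesgue_tuple_exists R n.
pose s := Num.min (r / 8) (1 / 4).
have s0 : 0 < s by rewrite lt_min !divr_gt0.
have sr : s <= r / 8 by rewrite ge_min lexx.
have s4 : s <= 1 / 4 by rewrite ge_min lexx orbT.
have mE := @measurable_eball R n s.
have mb := measurable_eudist_ball x r.
pose c := lincomb (- (1 / 2)) x 0 x.
have mc : measurable_fun setT (fun z : n.-tuple R => lincomb 1 z 1 c).
  by apply: measurable_lincomb_fun => //; exact: measurable_cst.
rewrite hmu// -(lebesgue_iint hlam); last exact: measurable_cone.
apply: (lt_le_trans (lebesgue_eball_gt0 hlam s0)).
rewrite -(lebesgue_translation_invariant hlam c mE).
apply: le_measure; rewrite ?inE.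
- exact: measurable_preimage.
- exact: measurable_cone.
move=> z; rewrite /eball/= => zs.
have x1 : enorm x = 1 := xS.
have dzx : eudist z (lincomb (1 / 2) x 0 x) <= s.
  apply: le_trans zs; rewrite le_eqVlt; apply/orP; left; apply/eqP.
  by congr enorm; apply: eq_from_tnth => i; rewrite /c !tnth_lincomb; ring.
have hx : enorm (lincomb (1 / 2) x 0 x) = 1 / 2.
  apply/eqP; rewrite -(@eqrXn2 _ 2) ?enorm_ge0// sqr_enorm !dotp_lincomb.
  by rewrite (iffLR (usphereP x) xS); apply/eqP; field.
have := le_trans (dist_enorm_le _ _) dzx; rewrite hx ler_norml => /andP[z1 z2].
have z0 : 0 < enorm z by lra.
split; first by rewrite z0/=; lra.
rewrite /=; apply: le_lt_trans (_ : 4 * s < r); last by lra.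
apply: le_trans (eudist_triangle (lincomb 2 z 0 z) _ _) _.
have -> : 4 * s = 2 * s + 2 * s by ring.
apply: lerD.
  rewrite (_ : eudist _ _ = 2 * eudist z (lincomb (1 / 2) x 0 x)).
    by rewrite ler_pM2l.
  apply/eqP; rewrite -(@eqrXn2 _ 2) ?mulr_ge0 ?eudist_ge0// exprMn !sqr_eudist.
  by rewrite !dotp_lincomb (dotpC z x); apply/eqP; field.
have nz : normalize z = lincomb (enorm z)^-1 z 0 z.
  by apply: eq_from_tnth => i; rewrite tnth_lincomb tnth_map mul0r addr0 mulrC.
have -> : eudist (lincomb 2 z 0 z) (normalize z) = `|2 * enorm z - 1|.
  apply/eqP; rewrite -(@eqrXn2 _ 2) ?normr_ge0 ?eudist_ge0//.
  rewrite real_normK ?num_real// sqr_eudist nz !dotp_lincomb -sqr_enorm.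
  by apply/eqP; field; exact: lt0r_neq0.
by rewrite ler_norml; lra.
Qed.

Lemma integral_mirror u (f : n.-tuple R -> \bar R) : dotp u u = 1 ->
  measurable_fun setT f -> (forall x, 0 <= f x)%E ->
  (\int[mu]_x f (mirror u x) = \int[mu]_x f x)%E.
Proof.
move=> u1 mf f0; apply: esym.
apply: (integral_image_measure (@measurable_mirror R n u)) => // A mA.
exact/esym/cone_measure_mirror.
Qed.

End ConeMeasureTheory.

(** * Polarization of Lipschitz functions *)

Section Lipschitz.
Context {R : realType} {n : nat}.
Implicit Types (g : n.-tuple R -> R) (x y u : n.-tuple R).

Definition lip1 g := forall x y, g x - g y <= eudist x y.

Lemma rat_tuple_dense x r : 0 < r ->
  exists q : n.-tuple rat, eudist (map_tuple ratr q) x < r.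
Proof.
move=> r0; pose s := (r / 2) / n.+1%:R.
have s0 : 0 < s by rewrite !divr_gt0.
have H i : {q : rat | tnth x i - s < ratr q < tnth x i + s}.
  apply/cid; have [|q] := @rat_in_itvoo R (tnth x i - s) (tnth x i + s).
    by lra.
  by rewrite in_itv/= => ?; exists q.
exists [tuple sval (H i) | i < n].
apply: (@le_lt_trans _ _ (r / 2)); last by lra.
apply: (box_sub_eball (ltW (_ : 0 < r / 2))); first by rewrite divr_gt0.
move=> i; rewrite tnth_lincomb tnth_map tnth_mktuple.
case: (H i) => q /= /andP[q1 q2]; rewrite ler_norml -/s; apply/andP; split; lra.
Qed.

Lemma lip1_measurable g : lip1 g -> measurable_fun setT g.
Proof.
move=> gL _; apply: (measurability _ (RGenInftyO.measurableE R)) => //.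
move=> /= _ [_ [a ->] <-]; rewrite setTI.
rewrite (_ : _ @^-1` _ = \bigcup_(q in [set: n.-tuple rat])
    [set x | eudist (map_tuple ratr q) x < a - g (map_tuple ratr q)]).
  apply: countable_bigcupT_measurable; first exact: countableP.
  by move=> q; exact: measurable_eudist_ball.
apply/seteqP; split => x /=; rewrite in_itv/=.
  move=> ga; have [|q qx] := @rat_tuple_dense x ((a - g x) / 2).
    by rewrite divr_gt0// subr_gt0.
  by exists q => //=; have := gL (map_tuple ratr q) x; lra.
by move=> [q _ /=]; have := gL x (map_tuple ratr q); rewrite eudistC; lra.
Qed.

Definition polar u g x :=
  if 0 <= dotp x u then Num.min (g x) (g (mirror u x))
  else Num.max (g x) (g (mirror u x)).

Lemma polar_lip1 u g : dotp u u = 1 -> lip1 g -> lip1 (polar u g).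
Proof.
move=> u1 gL x y.
have h1 := gL x y.
have h2 := gL (mirror u x) (mirror u y); rewrite eudist_mirror// in h2.
have side v w : 0 <= dotp v u * - dotp w u -> eudist v (mirror u w) <= eudist v w.
  move=> h; rewrite -{2}(mirrorK u1 w); apply: eudist_mirror_le => //.
  by rewrite dotp_mirror_pole.
rewrite /polar; case: ifPn => hx; case: ifPn => hy.
- by rewrite minEle; case: ifP => ?; rewrite minEle; case: ifP => ?; lra.
- by rewrite minEle; case: ifP => ?; rewrite maxEle; case: ifP => ?; lra.
- have hs : eudist x (mirror u y) <= eudist x y.
    by apply: side; rewrite -ltNge in hx; nra.
  have h3 := gL x (mirror u y).
  have h4 := gL (mirror u x) y.
  rewrite -(eudist_mirror _ _ u1) mirrorK// in h4.
  by rewrite minEle; case: ifP => ?; rewrite maxEle; case: ifP => ?; lra.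
- by rewrite maxEle; case: ifP => ?; rewrite maxEle; case: ifP => ?; lra.
Qed.

Lemma polar_minmax u g x : dotp u u = 1 -> 0 <= dotp x u ->
  polar u g x = Num.min (g x) (g (mirror u x)) /\
  polar u g (mirror u x) = Num.max (g x) (g (mirror u x)).
Proof.
move=> u1 d0; rewrite /polar dotp_mirror_pole// mirrorK// d0.
rewrite oppr_ge0 (maxC (g (mirror _ _))); split => //.
case: ifPn => // d0'.
have -> : mirror u x = x.
  apply: eq_from_tnth => i; rewrite tnth_lincomb (_ : dotp x u = 0); first by ring.
  by apply/eqP; rewrite eq_le d0 d0'.
by rewrite minxx maxxx.
Qed.

Lemma polar_maxmin u g x : dotp u u = 1 -> dotp x u < 0 ->
  polar u g x = Num.max (g x) (g (mirror u x)) /\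
  polar u g (mirror u x) = Num.min (g x) (g (mirror u x)).
Proof.
move=> u1 d0; rewrite /polar dotp_mirror_pole// mirrorK//.
by rewrite leNgt d0 /= oppr_ge0 (ltW d0) (minC (g (mirror _ _))).
Qed.

Lemma polar_pair u g x : dotp u u = 1 ->
  (polar u g x = g x /\ polar u g (mirror u x) = g (mirror u x)) \/
  (polar u g x = g (mirror u x) /\ polar u g (mirror u x) = g x).
Proof.
move=> u1; have [d0|d0] := leP 0 (dotp x u).
- have [-> ->] := polar_minmax g u1 d0.
  by rewrite minEle maxEle; case: ifP; [left|right].
- have [-> ->] := polar_maxmin g u1 d0.
  by rewrite minEle maxEle; case: ifP; [right|left].
Qed.

End Lipschitz.

(** * Near minimizers of the moment *)

Section Isoperimetry.
Context {R : realType} {n : nat} (mu : {finite_measure set (n.-tuple R) -> \bar R}).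
Hypothesis hmu : is_cone_measure mu.
Variable e : n.-tuple R.
Hypothesis he : dotp e e = 1.
Implicit Types (g : n.-tuple R -> R) (x y u : n.-tuple R).

Lemma lee_double (x y : \bar R) : (x + x <= y + y)%E -> (x <= y)%E.
Proof.
move=> xy; rewrite leNgt; apply/negP => yx.
by move: xy; rewrite leNgt lteD.
Qed.

Lemma integral_pair_le u (a b c : n.-tuple R -> \bar R) : dotp u u = 1 ->
  measurable_fun setT a -> measurable_fun setT b -> measurable_fun setT c ->
  (forall x, 0 <= a x)%E -> (forall x, 0 <= b x)%E -> (forall x, 0 <= c x)%E ->
  (forall x, a x + a (mirror u x) + c x <= b x + b (mirror u x))%E ->
  (\int[mu]_x a x + \int[mu]_x a x + \int[mu]_x c x <=
   \int[mu]_x b x + \int[mu]_x b x)%E.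
Proof.
move=> u1 ma mb mc a0 b0 c0 h.
have ms (f : n.-tuple R -> \bar R) : measurable_fun setT f ->
    measurable_fun setT (fun x => f (mirror u x)).
  by move=> mf; apply: measurableT_comp => //; exact: measurable_mirror.
have msa := ms _ ma; have msb := ms _ mb.
rewrite -{2}(integral_mirror hmu u1 ma a0) -{2}(integral_mirror hmu u1 mb b0).
rewrite -!ge0_integralD//.
- apply: ge0_le_integral => //.
  + by move=> x _; rewrite !adde_ge0.
  + by apply: emeasurable_funD => //; exact: emeasurable_funD.
  + exact: emeasurable_funD.
- by move=> x _; rewrite adde_ge0.
- exact: emeasurable_funD.
Qed.

Lemma measurable_polar u g : dotp u u = 1 -> lip1 g ->
  measurable_fun setT (polar u g).
Proof. by move=> u1 gL; apply: lip1_measurable; exact: polar_lip1. Qed.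

Lemma integral_pair_mono u (a b : n.-tuple R -> \bar R) : dotp u u = 1 ->
  measurable_fun setT a -> measurable_fun setT b ->
  (forall x, 0 <= a x)%E -> (forall x, 0 <= b x)%E ->
  (forall x, a x + a (mirror u x) <= b x + b (mirror u x))%E ->
  (\int[mu]_x a x <= \int[mu]_x b x)%E.
Proof.
move=> u1 ma mb a0 b0 h; apply: lee_double.
have := @integral_pair_le u a b (cst 0%E) u1 ma mb (measurable_cst _) a0 b0
  (fun=> lexx _).
rewrite integral0 adde0; apply => x; rewrite /= adde0; exact: h.
Qed.

Lemma polar_equimeasurable u g P : dotp u u = 1 -> lip1 g -> measurable P ->
  mu (polar u g @^-1` P) = mu (g @^-1` P).
Proof.
move=> u1 gL mP.
have mg := lip1_measurable gL; have mp := measurable_polar u1 gL.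
have mgP : measurable (g @^-1` P) by exact: measurable_preimage.
have mpP : measurable (polar u g @^-1` P) by exact: measurable_preimage.
have E f : measurable_fun setT f -> mu (f @^-1` P) = (\int[mu]_x (\1_P (f x))%:E)%E.
  move=> mf; transitivity (\int[mu]_x (\1_(f @^-1` P) x : R)%:E)%E.
    by rewrite integral_indic// ?setIT//; exact: measurable_preimage.
  by [].
have M f : measurable_fun setT f ->
    measurable_fun setT (fun x : n.-tuple R => (\1_P (f x) : R)%:E).
  move=> mf; apply/measurable_EFinP.
  apply: (@measurableT_comp _ _ _ _ _ _ (\1_P : R -> R) _ f) => //.
have I0 f x : (0 <= (\1_P (f x : R) : R)%:E)%E by rewrite lee_fin.
rewrite !E//; apply/eqP; rewrite eq_le; apply/andP; split;
  apply: (integral_pair_mono u1); [exact: M|exact: M|by []|by []| |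
                                   exact: M|exact: M|by []|by []|] => x;
  by have [[-> ->]|[-> ->]] := polar_pair g x u1; rewrite // addeC.
Qed.

Definition admissible (c0 m : \bar R) (r : R) g :=
  [/\ lip1 g, forall x, 0 <= g x <= 2,
      (c0 <= mu [set x | g x <= 0]%R)%E & (mu [set x | g x < r]%R <= m)%E].

Lemma polar_admissible c0 m r u g : dotp u u = 1 ->
  admissible c0 m r g -> admissible c0 m r (polar u g).
Proof.
move=> u1 [gL g2 g0 gr]; split.
- exact: polar_lip1.
- by move=> x; have [[-> _]|[-> _]] := polar_pair g x u1; exact: g2.
- have := polar_equimeasurable u1 gL (measurable_itv `]-oo, 0]).
  have E f : f @^-1` `]-oo, 0] = [set x : n.-tuple R | f x <= 0].
    by apply/seteqP; split => x /=; rewrite in_itv.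
  by rewrite !E => ->.
- have := polar_equimeasurable u1 gL (measurable_itv `]-oo, r[).
  have E f : f @^-1` `]-oo, r[ = [set x : n.-tuple R | f x < r].
    by apply/seteqP; split => x /=; rewrite in_itv.
  by rewrite !E => ->.
Qed.

(* On the sphere this is [1 + dotp x e]; the term [enorm x] makes it
   nonnegative everywhere. *)
Definition height x := enorm x + dotp x e.

Lemma dotp_pole_le x : `|dotp x e| <= enorm x.
Proof.
rewrite -ler_sqr ?nnegrE ?enorm_ge0// real_normK ?num_real// sqr_enorm.
by have := cauchy_schwarz x e; rewrite he mulr1.
Qed.

Lemma height_ge0 x : 0 <= height x.
Proof. by have := dotp_pole_le x; rewrite ler_norml /height => /andP[]; lra. Qed.

Lemma measurable_height : measurable_fun setT height.
Proof.
apply: measurable_funD; first exact: measurable_enorm.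
by apply: measurable_dotp => //; exact: measurable_cst.
Qed.

Definition moment g := (\int[mu]_x (g x * height x)%:E)%E.

Lemma measurable_moment g : lip1 g ->
  measurable_fun setT (fun x => (g x * height x)%:E).
Proof.
move=> gL; apply/measurable_EFinP; apply: measurable_funM.
  exact: lip1_measurable.
exact: measurable_height.
Qed.

Lemma moment_ge0 g : (forall x, 0 <= g x) -> (0 <= moment g)%E.
Proof.
by move=> g0; apply: integral_ge0 => x _; rewrite lee_fin mulr_ge0 ?height_ge0.
Qed.

Lemma moment_fin g : lip1 g -> (forall x, 0 <= g x <= 2) ->
  moment g \is a fin_num.
Proof.
move=> gL g2; have g0 x : 0 <= g x by have /andP[] := g2 x.
rewrite ge0_fin_numE ?moment_ge0//.
have mS := @measurable_usphere R n.
have mm := measurable_moment gL.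
rewrite /moment -(setUv (usphere n)) ge0_integral_setU//=.
- rewrite [X in (_ + X)%E]null_set_integral ?adde0//.
  + apply: (@le_lt_trans _ _ (\int[mu]_(x in usphere n) 4%:E)%E).
      apply: ge0_le_integral => //.
      * by move=> x _; rewrite lee_fin mulr_ge0 ?height_ge0.
      * exact: measurable_funTS.
      * move=> x /= xS; rewrite lee_fin.
        have := dotp_pole_le x; have := height_ge0 x; have := g2 x.
        rewrite /height xS ler_norml => /andP[? ?] ? /andP[? ?].
        nra.
    rewrite integral_cst// lte_mul_pinfty ?lee_fin//.
    by rewrite -ge0_fin_numE// fin_num_measure.
  + exact: measurableC.
  + exact: measurable_funTS.
  + exact: cone_measure_off_sphere.
- exact: measurableC.
- by rewrite setUv.
- by move=> x _; rewrite lee_fin mulr_ge0 ?height_ge0.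
- by apply/disj_setPS; rewrite setICr.
Qed.

Lemma near_minimizer c0 m r g0 eta : admissible c0 m r g0 -> 0 < eta ->
  exists2 g, admissible c0 m r g &
    forall g', admissible c0 m r g' -> (moment g < moment g' + eta%:E)%E.
Proof.
move=> a0 eta0.
pose A := [set fine (moment g) | g in admissible c0 m r].
have fin g : admissible c0 m r g -> moment g \is a fin_num.
  by case=> gL g2 _ _; exact: moment_fin.
have lbA : lbound A 0.
  move=> _ [g [gL g2 _ _] <-]; apply/fine_ge0/moment_ge0 => x.
  by have /andP[] := g2 x.
have hA : has_inf A by split; [exists (fine (moment g0)), g0|exists 0].
have [_ [g ga <-] gi] := inf_adherent eta0 hA.
exists g => // g' ga'.
rewrite -(fineK (fin _ ga)) -(fineK (fin _ ga')) -EFinD lte_fin.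
apply: lt_le_trans gi _; rewrite lerD2r; apply: ge_inf; first by exists 0.
by exists g'.
Qed.

Definition uball x (rho : R) := [set y : n.-tuple R | eudist x y < rho].

Lemma measure_uball x rho : usphere n x -> mu (uball x rho) = mu (uball e rho).
Proof.
move=> xS; have [d0|d0] := eqVneq (eudist x e) 0.
  congr (mu _); apply/seteqP; split=> y; rewrite /uball/= => h.
    by have := eudist_triangle x e y; rewrite (eudistC e x) d0; lra.
  by have := eudist_triangle e x y; rewrite d0; lra.
have [|u1 xe] := @mirror_swap _ _ x e _ d0; first by rewrite he; apply/usphereP.
set u := lincomb _ _ _ _ in u1 xe.
have -> : uball x rho = mirror u @^-1` uball e rho.
  by apply/seteqP; split=> y; rewrite /uball/= -xe eudist_mirror.
by rewrite cone_measure_mirror//; exact: measurable_eudist_ball.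
Qed.

Lemma polar_gain g x y d th : lip1 g -> (forall x, 0 <= g x) ->
  usphere n x -> usphere n y -> 0 < d -> 0 < th ->
  dotp y e + d <= dotp x e -> g y + th <= g x ->
  exists2 u, dotp u u = 1 &
   (moment (polar u g) + moment (polar u g) +
    (th * d / 4)%:E * mu (uball e (Num.min th d / 4)) <=
    moment g + moment g)%E.
Proof.
move=> gL g0 xS yS d0 th0 hxy gxy.
have xy0 : eudist x y != 0.
  by apply/eqP => h; have := gL x y; rewrite h; lra.
have [|u1] := @mirror_swap _ _ x y _ xy0.
  by rewrite (iffLR (usphereP x) xS) (iffLR (usphereP y) yS).
set u := lincomb _ _ _ _ => xuy; exists u => //.
have ue0 : 0 < dotp u e.
  rewrite /u dotp_lincombl mulNr -mulrBr mulr_gt0 ?invr_gt0 ?lt_def ?xy0 ?eudist_ge0//=.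
  by lra.
set rho := Num.min th d / 4.
have rth : rho <= th / 4 by rewrite ler_pM2r// ge_min lexx.
have rd : rho <= d / 4 by rewrite ler_pM2r// ge_min lexx orbT.
have mB := measurable_eudist_ball x rho.
have cE : (\int[mu]_z (th * d / 4 * \1_(uball x rho) z)%:E =
    (th * d / 4)%:E * mu (uball e rho))%E.
  rewrite -(measure_uball rho xS); under eq_integral do rewrite EFinM.
  rewrite ge0_integralZl//.
  - by rewrite integral_indic// setIT.
  - by apply/measurable_EFinP; exact: measurable_indic.
  - by rewrite lee_fin !mulr_ge0// ltW.
rewrite -cE; apply: (integral_pair_le u1).
- by apply: measurable_moment; exact: polar_lip1.
- exact: measurable_moment.
- apply/measurable_EFinP; apply: measurable_funM => //; exact: measurable_indic.
- move=> z; rewrite lee_fin mulr_ge0 ?height_ge0//.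
  by have [[-> _]|[-> _]] := polar_pair g z u1.
- by move=> z; rewrite lee_fin mulr_ge0 ?height_ge0.
- by move=> z; rewrite lee_fin !mulr_ge0// ltW.
move=> z; rewrite -!EFinD lee_fin.
have hd : height z - height (mirror u z) = 2 * dotp z u * dotp u e.
  by rewrite /height enorm_mirror// dotp_lincombl; ring.
have near : uball x rho z -> [/\ th / 2 <= g z - g (mirror u z) &
    d / 2 <= height z - height (mirror u z)].
  rewrite /uball/= => zx.
  have zy : eudist (mirror u z) y < rho.
    by rewrite -xuy eudist_mirror// eudistC.
  have e1 : enorm e = 1 by rewrite /enorm he sqrtr1.
  split.
    have := gL x z; have := gL (mirror u z) y; lra.
  have := dotpB_le_eudist x z e; have := dotpB_le_eudist (mirror u z) y e.
  by rewrite e1 /height enorm_mirror//; lra.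
pose c : R := \1_(uball x rho) z.
have hc : c = 0 \/ (c = 1 /\ uball x rho z).
  by rewrite /c indicE; have [|] := boolP (z \in _); rewrite ?inE; [right|left].
rewrite -/c; set p := g z in near *; set q := g (mirror u z) in near *.
set h1 := height z in hd near *; set h2 := height (mirror u z) in hd near *.
have [z0|z0] := leP 0 (dotp z u).
  have [-> ->] := polar_minmax g u1 z0.
  have hz : 0 <= h1 - h2 by rewrite hd !mulr_ge0// ltW.
  rewrite -/p -/q minEle maxEle.
  case: hc => [->|[-> /near[n1 n2]]]; case: ifP => pq; first [lra|nra].
have hz : h1 - h2 <= 0 by rewrite hd; nra.
have [-> ->] := polar_maxmin g u1 z0; rewrite -/p -/q minEle maxEle.
case: hc => [->|[-> /near[n1 n2]]]; last by lra.
by case: ifP => pq; first [lra|nra].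
Qed.

(* A near minimizer of the moment cannot be improved much by polarization,
   so by [polar_gain] it is almost a decreasing function of [dotp x e]. *)
Lemma almost_monotone c0 m r g0 d th : admissible c0 m r g0 ->
  usphere n e -> 0 < d -> 0 < th ->
  exists2 g, admissible c0 m r g &
    forall x y, usphere n x -> usphere n y ->
      dotp y e + d <= dotp x e -> g x < g y + th.
Proof.
move=> a0 eS d0 th0; set rho := Num.min th d / 4.
have rho0 : 0 < rho by rewrite divr_gt0// lt_min th0.
have b0 := cone_measure_ball_gt0 hmu eS rho0.
have bfin : mu (uball e rho) \is a fin_num.
  by rewrite fin_num_measure//; exact: measurable_eudist_ball.
pose eta := th * d / 4 * fine (mu (uball e rho)) / 2.
have etaE : ((th * d / 4)%:E * mu (uball e rho) = eta%:E + eta%:E)%E.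
  by rewrite -(fineK bfin) -EFinM -EFinD; congr EFin; rewrite /eta; field.
have eta0 : 0 < eta.
  by rewrite !mulr_gt0//; apply: fine_gt0; rewrite b0 -ge0_fin_numE ?ltW.
have [g ga gmin] := near_minimizer a0 eta0.
exists g => // x y xS yS hxy; rewrite ltNge; apply/negP => gxy.
have [gL g2 _ _] := ga.
have gp z : 0 <= g z by have /andP[] := g2 z.
have [u u1] := polar_gain gL gp xS yS d0 th0 hxy gxy.
have pa := polar_admissible u1 ga; have := gmin _ pa.
have [pL p2 _ _] := pa.
rewrite -/rho etaE -(fineK (moment_fin gL g2)) -(fineK (moment_fin pL p2)).
rewrite -!EFinD lte_fin lee_fin; lra.
Qed.

End Isoperimetry.

(** * Comparison with caps *)

Section CapComparison.
Context {R : realType} {n : nat} (mu : {finite_measure set (n.-tuple R) -> \bar R}).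
Hypothesis hmu : is_cone_measure mu.
Variables e w : n.-tuple R.
Hypotheses (he : dotp e e = 1) (hw : dotp w w = 1) (hew : dotp w e = 0).
Implicit Types (g : n.-tuple R -> R) (x y u : n.-tuple R).

Lemma measurable_dotp_itv (v : n.-tuple R) (i : interval R) :
  measurable [set x : n.-tuple R | dotp x v \in i].
Proof.
rewrite (_ : mkset _ = (fun x => dotp x v) @^-1` [set` i]) //.
apply: measurable_preimage; last exact: measurable_itv.
by apply: measurable_dotp => //; exact: measurable_cst.
Qed.

Lemma measure_sphere B : measurable B -> mu B = mu (usphere n `&` B).
Proof.
move=> mB; have mS := @measurable_usphere R n.
rewrite -[in LHS](setIT B) -(setUv (usphere n)) setIUr measureU//.
- rewrite [X in (_ + X)%E](_ : _ = 0%E) ?adde0 1?setIC//.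
  apply/eqP; rewrite eq_le measure_ge0 andbT -(cone_measure_off_sphere hmu).
  apply: le_measure; rewrite ?inE//.
  + by apply: measurableI => //; exact: measurableC.
  + exact: measurableC.
- exact: measurableI.
- by apply: measurableI => //; exact: measurableC.
- by rewrite setICA !setIA -setIA setICr setI0.
Qed.

Lemma low_point (c0 : \bar R) (A : set (n.-tuple R)) (d : R) :
  (mu (usphere n) <= c0 + c0)%E -> measurable A -> (c0 <= mu A)%E -> 0 < d ->
  exists y, [/\ usphere n y, A y & dotp y e <= d].
Proof.
move=> cS mA cg d0; apply: contrapT => no.
have mS := @measurable_usphere R n.
have mdo := measurable_dotp_itv e.
pose P := usphere n `&` [set x | dotp x e \in `]d, +oo[].
pose N := usphere n `&` [set x | dotp x e \in `]-oo, -d[].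
pose b := usphere n `&` uball w d.
have mP : measurable P by exact: measurableI.
have mN : measurable N by exact: measurableI.
have mb : measurable b.
  by apply: measurableI => //; exact: measurable_eudist_ball.
have cP : (c0 <= mu P)%E.
  apply: le_trans cg _; rewrite measure_sphere//.
  apply: le_measure; rewrite ?inE//; first exact: measurableI.
  move=> x [/= xS gx]; split => //=; rewrite in_itv/= andbT ltNge; apply/negP => h.
  by apply: no; exists x.
have NP : mu N = mu P.
  rewrite -(cone_measure_mirror hmu he mP); congr (mu _).
  apply/seteqP; split => x [/= xS]; rewrite /= in_itv/= ?andbT => h; split.
  - exact/usphere_mirror.
  - by rewrite /= in_itv/= dotp_mirror_pole// andbT; lra.
  - by apply/(usphere_mirror x he).
  - by move: h; rewrite /= in_itv/= dotp_mirror_pole//; lra.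
have b0 : (0 < mu b)%E.
  rewrite /b -measure_sphere; last exact: measurable_eudist_ball.
  by apply: cone_measure_ball_gt0 => //; apply/usphereP.
have e1 : enorm e = 1 by rewrite /enorm he sqrtr1.
have bd x : b x -> `|dotp x e| < d.
  move=> [_ /= wx]; apply: le_lt_trans wx; rewrite ler_norml.
  have := dotpB_le_eudist x w e; have := dotpB_le_eudist w x e.
  by rewrite hew e1 (eudistC x w); lra.
have : (mu P + mu N + mu b <= mu (usphere n))%E.
  rewrite -measureU//; last first.
    by apply/seteqP; split => x // -[[_ /=]]; rewrite in_itv/= andbT => ?;
      move=> [_ /=]; rewrite in_itv/=; lra.
  rewrite -measureU//; last 2 first.
  - exact: measurableU.
  - apply/seteqP; split => x // -[[]] [_ /=]; rewrite in_itv/= ?andbT => h /bd;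
      by rewrite ltr_norml; lra.
  apply: le_measure; rewrite ?inE//.
    by apply: measurableU => //; exact: measurableU.
  by move=> x [[|]|] [].
rewrite NP; apply/negP; rewrite -ltNge.
apply: (le_lt_trans cS); apply: (@le_lt_trans _ _ (mu P + mu P)%E).
  exact: leeD.
by rewrite lteDl// fin_numD fin_num_measure.
Qed.

Lemma eudist_sphere x y : usphere n x -> usphere n y ->
  eudist x y = Num.sqrt (2 - 2 * dotp x y).
Proof.
move=> /usphereP x1 /usphereP y1; rewrite /eudist /enorm; congr Num.sqrt.
by rewrite !dotp_lincomb (dotpC y x) x1 y1; ring.
Qed.

Lemma sin_le_pihalf (a b : R) : - (pi / 2) <= a -> a <= b -> b <= pi / 2 ->
  sin a <= sin b.
Proof.
move=> a1 ab b1; rewrite leNgt ltr_sin ?in_itv/= ?ltNge ?ab//.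
  by rewrite b1 (le_trans a1).
by rewrite a1 (le_trans ab).
Qed.

(* Moving by the angle [b] along the great circle from [x] through the pole. *)
Lemma rotate_towards_pole x (a b : R) : 0 < a < b -> 2 * b - a <= pi / 2 ->
  usphere n x -> - sin a <= dotp x e < sin (b - a) ->
  exists z, [/\ usphere n z, sin (b - a) <= dotp z e & dotp x z = cos b].
Proof.
move=> /andP[a0 ab] bpi /usphereP x1 /andP[t1 t2].
have bp : b < pi / 2 by lra.
set t := dotp x e in t1 t2 *.
have sa : sin a < 1.
  by rewrite -(sin_pihalf R) ltr_sin ?in_itv/=; lra.
have sba : sin (b - a) < 1.
  by rewrite -(sin_pihalf R) ltr_sin ?in_itv/=; lra.
have t11 : -1 <= - t <= 1 by lra.
pose c := asin (- t).
have sc : sin c = - t by rewrite asinK// in_itv/=.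
have c1 : - (pi / 2) <= c by apply: asin_geNpi2.
have c2 : c <= pi / 2 by apply: asin_lepi2.
have ca : c <= a.
  rewrite leNgt; apply/negP => h; have : sin a < sin c.
    by rewrite ltr_sin ?in_itv/=; lra.
  by rewrite sc; lra.
have cb : a - b < c.
  rewrite ltNge; apply/negP => h; have : sin c <= sin (a - b).
    by apply: sin_le_pihalf; lra.
  by rewrite sc -(opprB b a) sinN; lra.
have k0 : 0 < cos c by apply: cos_gt0_pihalf; lra.
have k2 : cos c ^+ 2 = 1 - t ^+ 2 by rewrite cos2sin2 sc; ring.
pose v := lincomb (cos c)^-1 e (- t / cos c) x.
have xv : dotp x v = 0.
  by rewrite dotp_lincombr x1 -/t; field; exact: lt0r_neq0.
have vv : dotp v v = 1.
  rewrite /v !dotp_lincomb x1 he (dotpC e x) -/t.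
  rewrite (_ : _ + _ = (1 - t ^+ 2) / cos c ^+ 2); last by field; exact: lt0r_neq0.
  by rewrite -k2 divff// expf_neq0// lt0r_neq0.
have ve : dotp v e = cos c.
  rewrite /v dotp_lincombl he -/t.
  rewrite (_ : _ + _ = (1 - t ^+ 2) / cos c); last by field; exact: lt0r_neq0.
  by rewrite -k2; field; exact: lt0r_neq0.
clearbody v; exists (lincomb (cos b) x (sin b) v); split.
- apply/usphereP; rewrite !dotp_lincomb (dotpC v x) xv x1 vv.
  by rewrite -[RHS](cos2Dsin2 b); ring.
- rewrite dotp_lincombl -/t ve.
  rewrite [leRHS](_ : _ = sin (b - c)); last by rewrite sinB sc; ring.
  by apply: sin_le_pihalf; lra.
- by rewrite dotp_lincombr x1 xv; ring.
Qed.

Lemma admissible_cap_le (c0 m : \bar R) (a b : R) g0 :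
  (mu (usphere n) <= c0 + c0)%E -> 0 < a < b -> b <= pi / 2 ->
  admissible mu c0 m (Num.sqrt (2 - 2 * cos b)) g0 ->
  (mu (usphere n `&` [set x | - sin a <= dotp x e]%R) <= m)%E.
Proof.
move=> cS /andP[a0 ab] bpi adm.
pose s := (a + b) / 2.
have s1 : 0 < s - a by rewrite /s; lra.
have sl : sin (s - a) > 0 by apply: sin_gt0_pihalf; rewrite /s; lra.
have cosl : cos b < cos s by rewrite ltr_cos ?in_itv/= /s; lra.
have cs1 : cos s <= 1 by exact: cos_le1.
have rs : Num.sqrt (2 - 2 * cos s) < Num.sqrt (2 - 2 * cos b).
  by rewrite ltr_sqrt; lra.
set r := Num.sqrt (2 - 2 * cos b) in adm rs; set rs' := Num.sqrt _ in rs.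
have rs0 : 0 <= rs' by exact: sqrtr_ge0.
have eS : usphere n e by exact/usphereP.
pose d := sin (s - a) / 2.
have d0 : 0 < d by rewrite divr_gt0.
have th0 : 0 < r - rs' by lra.
have [g ga gmono] := almost_monotone hmu he adm eS d0 th0.
have [gL g2 gc gr] := ga.
have mg0 : measurable [set x | g x <= 0].
  rewrite (_ : mkset _ = g @^-1` `]-oo, 0]).
    by apply: measurable_preimage; [exact: lip1_measurable|exact: measurable_itv].
  by apply/seteqP; split => x /=; rewrite in_itv.
have [y [yS /= gy ye]] := low_point cS mg0 gc d0.
apply: le_trans gr; apply: le_measure; rewrite ?inE.
- apply: measurableI; first exact: measurable_usphere.
  rewrite (_ : mkset _ = [set x | dotp x e \in `[- sin a, +oo[]).
    exact: measurable_dotp_itv.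
  by apply/seteqP; split => x /=; rewrite in_itv/= andbT.
- rewrite (_ : mkset _ = g @^-1` `]-oo, r[).
    by apply: measurable_preimage; [exact: lip1_measurable|exact: measurable_itv].
  by apply/seteqP; split => x /=; rewrite in_itv.
move=> x [xS /= xe].
have [h|h] := leP (sin (s - a)) (dotp x e).
  have := gmono x y xS yS; rewrite /d in ye *; lra.
have as1 : 0 < a < s by rewrite /s; lra.
have as2 : 2 * s - a <= pi / 2 by rewrite /s; lra.
have [|z [zS ze xz]] := rotate_towards_pole as1 as2 xS; first by rewrite xe h.
have := gmono z y zS yS; have := gL x z.
rewrite eudist_sphere// xz -/rs' /d in ye *; lra.
Qed.

Lemma neighbourhood_measure (A : set (n.-tuple R)) (b : R) :
  measurable A -> A `<=` usphere n -> (mu (usphere n) <= mu A + mu A)%E ->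
  0 < b <= pi / 2 ->
  exists B, [/\ measurable B,
    B `<=` [set x | usphere n x /\ exists2 y, A y & cos b <= dotp x y] &
    forall a, 0 < a < b ->
      (mu (usphere n `&` [set x | - sin a <= dotp x e]%R) <= mu B)%E].
Proof.
move=> mA AS hA /andP[b0 bpi].
have eS : usphere n e by exact/usphereP.
have mS := @measurable_usphere R n.
have [y0 y0A] : A !=set0.
  apply/set0P/negP => /eqP A0; move: hA; rewrite A0 measure0 adde0; apply/negP.
  rewrite -ltNge; apply: lt_le_trans (cone_measure_ball_gt0 hmu eS ltr01) _.
  rewrite (measure_sphere (measurable_eudist_ball e 1)).
  apply: le_measure; rewrite ?inE//.
  by apply: measurableI => //; exact: measurable_eudist_ball.
pose D x := [set eudist x y | y in A].
have hD x : has_inf (D x).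
  split; first by exists (eudist x y0), y0.
  by exists 0 => _ [y _ <-]; exact: eudist_ge0.
have Dle x y : A y -> inf (D x) <= eudist x y.
  by move=> Ay; apply: ge_inf; [have [] := hD x|exists y].
pose g x := Num.min 2 (inf (D x)).
have gL : lip1 g.
  move=> x y; have D1 : inf (D x) - eudist x y <= inf (D y).
    apply: lb_le_inf; first by have [] := hD y.
    move=> _ [z Az <-]; have := Dle x z Az; have := eudist_triangle y x z; lra.
  have := eudist_ge0 x y; rewrite /g !minEle.
  by case: ifP => ?; case: ifP => ?; lra.
have g2 x : 0 <= g x <= 2.
  rewrite /g le_min ge_min lexx /= andbT; apply/andP; split => //.
  by apply: lb_le_inf; [have [] := hD x|move=> _ [y _ <-]; exact: eudist_ge0].
have r2 : Num.sqrt (2 - 2 * cos b) < 2.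
  have : Num.sqrt (2 - 2 * cos b) <= Num.sqrt 2.
    rewrite ler_sqrt//; have : 0 <= cos b by apply: cos_ge0_pihalf; lra.
    by lra.
  move=> /le_lt_trans; apply.
  by rewrite -[ltRHS]ger0_norm// -sqrtr_sqr ltr_sqrt; lra.
set r := Num.sqrt _ in r2.
have mgr : measurable [set x | g x < r].
  rewrite (_ : mkset _ = g @^-1` `]-oo, r[).
    by apply: measurable_preimage; [exact: lip1_measurable|exact: measurable_itv].
  by apply/seteqP; split => x /=; rewrite in_itv.
have mg0 : measurable [set x | g x <= 0].
  rewrite (_ : mkset _ = g @^-1` `]-oo, 0]).
    by apply: measurable_preimage; [exact: lip1_measurable|exact: measurable_itv].
  by apply/seteqP; split => x /=; rewrite in_itv.
exists (usphere n `&` [set x | g x < r]); split.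
- exact: measurableI.
- move=> x [xS /= gx]; split => //; apply: contrapT => no.
  move: gx; apply/negP; rewrite -leNgt /g le_min (ltW r2)/=.
  apply: lb_le_inf; first by have [] := hD x.
  move=> _ [y Ay <-]; rewrite eudist_sphere//; last exact: AS.
  apply: ler_wsqrtr; have : dotp x y <= cos b.
    by rewrite leNgt; apply/negP => h; apply: no; exists y => //; exact: ltW.
  by lra.
- move=> a ab; apply: (@admissible_cap_le (mu A) _ a b g) => //; split => //.
  + apply: le_measure; rewrite ?inE// => x Ax /=.
    by rewrite /g ge_min; have := Dle x x Ax; rewrite eudistxx => ->; rewrite orbT.
  + by rewrite -/r -measure_sphere.
Qed.

End CapComparison.

(** * Gaussian bound for the cap profile *)

Section Calculus.
Context {R : realType}.
Implicit Types (f g : R -> R).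

Lemma is_derive_continuous f (x d : R) : is_derive x 1 f d -> {for x, continuous f}.
Proof.
by move=> h; apply: differentiable_continuous; apply/derivable1_diffP; exact: ex_derive.
Qed.

Lemma derive_ge0_le f f' (a b : R) : a <= b ->
  (forall x, a <= x <= b -> is_derive x 1 f (f' x)) ->
  (forall x, a < x < b -> 0 <= f' x) -> f a <= f b.
Proof.
move=> ab fd f'0.
apply: (@ger0_derive1_le_cc _ f a b); rewrite ?in_itv/= ?lexx ?ab//.
- move=> x; rewrite in_itv/= => /andP[xa xb].
  by have [] := fd x _; rewrite ?ltW.
- move=> x; rewrite in_itv/= => xab; rewrite derive1E.
  have xab' : a <= x <= b by case/andP: xab => *; rewrite !ltW.
  by rewrite (@derive_val _ _ _ _ _ _ _ (fd x xab')) f'0.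
- apply: continuous_in_subspaceT => x; rewrite inE/= in_itv/= => xab.
  exact: is_derive_continuous (fd x xab).
Qed.

Lemma derive_le0_le f f' (a b : R) : a <= b ->
  (forall x, a <= x <= b -> is_derive x 1 f (f' x)) ->
  (forall x, a < x < b -> f' x <= 0) -> f b <= f a.
Proof.
move=> ab fd f'0; rewrite -lerN2.
apply: (@derive_ge0_le (\- f) (\- f') a b) => // x xab.
  by have := fd x xab => ?; exact: is_deriveN.
by rewrite oppr_ge0 f'0.
Qed.

Lemma antiderivative_exists f (l : R) : continuous f ->
  exists H : R -> R, forall x, l < x -> is_derive x 1 H (f x).
Proof.
move=> cf; exists (fun x => (\int[lebesgue_measure]_(t in [set` `[l, x]]) f t)%R).
move=> x lx.
have [] := @continuous_FTC1_closed R f l x (x + 1) _ _ lx (cf x).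
- by rewrite ltrDl.
- apply: continuous_compact_integrable; first exact: segment_compact.
  exact: continuous_subspaceT.
by move=> h1 h2; apply: DeriveDef; [exact: h1|rewrite -derive1E; exact: h2].
Qed.

Lemma integral_antiderivative f F (a b : R) : a < b -> continuous f ->
  (forall x, a <= x <= b -> is_derive x 1 F (f x)) ->
  (\int[lebesgue_measure]_(x in `[a, b]) (f x)%:E = (F b - F a)%:E)%E.
Proof.
move=> ab cf Fd.
have Fc x : a <= x <= b -> {for x, continuous F}.
  by move=> xab; exact: is_derive_continuous (Fd x xab).
rewrite EFinB; apply: continuous_FTC2 => //.
- exact: continuous_subspaceT.
- split.
  + move=> x; rewrite in_itv/= => /andP[xa xb].
    by have [] := Fd x _; rewrite ?ltW.
  + by apply: cvg_at_right_filter; apply: Fc; rewrite lexx ltW.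
  + by apply: cvg_at_left_filter; apply: Fc; rewrite lexx ltW.
- move=> x; rewrite in_itv/= => /andP[xa xb]; rewrite derive1E.
  have xab : a <= x <= b by rewrite !ltW.
  exact: (@derive_val _ _ _ _ _ _ _ (Fd x xab)).
Qed.

Lemma sin_ge0_pihalf (x : R) : 0 <= x <= pi / 2 -> 0 <= sin x.
Proof. by move=> h; apply: sin_ge0_pi; have := pi_gt0 R; lra. Qed.

Lemma mulr_cos_le_sin (x : R) : 0 <= x <= pi / 2 -> x * cos x <= sin x.
Proof.
move=> /andP[x0 xpi].
have := @derive_ge0_le (sin - id * cos) (fun t => t * sin t) 0 x x0.
rewrite !fctE sin0 mul0r subr0 subr_ge0; apply=> [t _|t /andP[t0 tx]].
  by apply: is_derive_eq; rewrite /GRing.scale/=; ring.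
by rewrite mulr_ge0 ?(ltW t0)// sin_ge0_pihalf//; lra.
Qed.

Lemma cubic_cos_le_sin (x : R) : 0 <= x <= pi / 2 ->
  (x + x ^+ 3 / 3) * cos x <= sin x.
Proof.
move=> /andP[x0 xpi].
pose p : R -> R := id + 3^-1 *: (id * (id * id)).
have pE t : p t = t + t ^+ 3 / 3.
  by rewrite /p !fctE /GRing.scale/=; field.
have pd (t : R) : is_derive t 1 p (1 + t ^+ 2).
  have i1 : is_derive t 1 (id : R -> R) 1 by exact: is_derive_id.
  have i2 := is_deriveM i1 i1.
  have i3 := is_deriveM i1 i2.
  apply: (is_derive_eq (is_deriveD i1 (is_deriveZ 3^-1 i3))).
  by rewrite !fctE /GRing.scale/=; field.
have : (sin - p * cos) 0 <= (sin - p * cos) x.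
  apply: (@derive_ge0_le (sin - p * cos)
    (fun t => (t + t ^+ 3 / 3) * sin t - t ^+ 2 * cos t) 0 x x0).
    move=> t _.
    have := is_deriveB (is_derive_sin t) (is_deriveM (pd t) (is_derive_cos t)).
    move=> /is_derive_eq; apply; rewrite /GRing.scale/= pE; ring.
  move=> t /andP[t0 tx].
  have tpi : 0 <= t <= pi / 2 by lra.
  have h1 := mulr_cos_le_sin tpi; have h2 := sin_ge0_pihalf tpi.
  rewrite [leRHS](_ : _ = t * (sin t - t * cos t) + t ^+ 3 / 3 * sin t); last by ring.
  by rewrite addr_ge0 ?mulr_ge0 ?subr_ge0 ?divr_ge0 ?exprn_ge0 ?(ltW t0).
rewrite !fctE !pE sin0 expr0n/=; lra.
Qed.

Lemma gauss_cos_le (x y : R) : 0 <= x -> x <= y -> y <= pi / 2 ->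
  expR (y ^+ 2 / 2) * cos y <= expR (x ^+ 2 / 2) * cos x.
Proof.
move=> x0 xy ypi.
have : ((expR \o (2^-1 *: id ^+ 2)) * cos) y <=
       ((expR \o (2^-1 *: id ^+ 2)) * cos) x.
  apply: (@derive_le0_le _
    (fun t => expR (t ^+ 2 / 2) * (t * cos t - sin t))) => // t.
    move=> _; apply: is_derive_eq; rewrite !fctE /GRing.scale/=.
    by rewrite (_ : 2^-1 * t ^+ 2 = t ^+ 2 / 2); [field|ring].
  move=> /andP[t0 tx].
  have tpi : 0 <= t <= pi / 2 by lra.
  by rewrite mulr_ge0_le0 ?expR_ge0// subr_le0 mulr_cos_le_sin.
by rewrite !fctE /GRing.scale/= !(mulrC 2^-1).
Qed.

Lemma gauss_ratio_le (x y : R) : 0 <= x -> x <= y -> y < pi / 2 ->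
  x * expR (- x ^+ 2) * cos y <= y * expR (- y ^+ 2) * cos x.
Proof.
move=> x0 xy ypi.
have cp t : 0 <= t -> t <= y -> 0 < cos t.
  by move=> t0 ty; apply: cos_gt0_pihalf; lra.
suff : x * expR (- x ^+ 2) * (cos x)^-1 <= y * expR (- y ^+ 2) * (cos y)^-1.
  by rewrite ler_pdivrMr ?cp// mulrAC ler_pdivlMr ?cp//; lra.
have : ((id * (expR \o (- id ^+ 2))) * (fun t => (cos t)^-1)) x <=
  ((id * (expR \o (- id ^+ 2))) * (fun t => (cos t)^-1)) y.
  apply: (@derive_ge0_le _ (fun t => expR (- t ^+ 2) *
    ((1 - 2 * t ^+ 2) * cos t + t * sin t) * (cos t) ^- 2)) => // t.
    move=> /andP[xt ty]; have ct : cos t != 0 by rewrite gt_eqF ?cp//; lra.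
    by apply: is_derive_eq; rewrite !fctE /GRing.scale/=; field.
  move=> /andP[xt ty].
  have tpi : 0 <= t <= pi / 2 by lra.
  have ct : 0 < cos t by apply: cp; lra.
  rewrite mulr_ge0 ?invr_ge0 ?exprn_ge0 ?(ltW ct)//.
  rewrite mulr_ge0 ?expR_ge0//.
  have h1 : t * ((t + t ^+ 3 / 3) * cos t) <= t * sin t.
    by rewrite ler_wpM2l ?cubic_cos_le_sin//; lra.
  have : 0 <= cos t * (1 - t ^+ 2 + t ^+ 4 / 3).
    rewrite mulr_ge0 ?(ltW ct)//.
    rewrite (_ : _ + _ = (1 - t ^+ 2 / 2) ^+ 2 + t ^+ 4 / 12); last by field.
    by rewrite addr_ge0 ?sqr_ge0// divr_ge0// exprn_even_ge0.
  lra.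
by rewrite !fctE.
Qed.

Lemma gauss_ratio_pow_le (k : nat) (x y : R) : 0 <= x -> x <= y -> y < pi / 2 ->
  x * expR (- (k.+2%:R / 2) * x ^+ 2) * cos y ^+ k.+1 <=
  y * expR (- (k.+2%:R / 2) * y ^+ 2) * cos x ^+ k.+1.
Proof.
move=> x0 xy ypi.
have E t : expR (- (k.+2%:R / 2) * t ^+ 2) =
    expR (- t ^+ 2) * expR (- (t ^+ 2 / 2)) ^+ k.
  by rewrite -expRM_natl -expRD; congr expR; rewrite -addn2 natrD -mulr_natl; field.
have cx : 0 <= cos x by apply: cos_ge0_pihalf; lra.
have cy : 0 <= cos y by apply: cos_ge0_pihalf; lra.
have h1 := gauss_ratio_le x0 xy ypi.
have h2 : expR (- (x ^+ 2 / 2)) * cos y <= expR (- (y ^+ 2 / 2)) * cos x.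
  have h3 := gauss_cos_le x0 xy (ltW ypi).
  by rewrite !expRN ler_pdivrMl ?expR_gt0// mulrCA ler_pdivlMl ?expR_gt0.
rewrite !E.
rewrite [leLHS](_ : _ = x * expR (- x ^+ 2) * cos y *
  (expR (- (x ^+ 2 / 2)) * cos y) ^+ k); last first.
  by rewrite exprMn (exprS (cos y)); ring.
rewrite [leRHS](_ : _ = y * expR (- y ^+ 2) * cos x *
  (expR (- (y ^+ 2 / 2)) * cos x) ^+ k); last first.
  by rewrite exprMn (exprS (cos x)); ring.
apply: ler_pM => //.
- by rewrite !mulr_ge0 ?expR_ge0.
- by rewrite exprn_ge0// mulr_ge0 ?expR_ge0.
- by rewrite lerXn2r// nnegrE mulr_ge0 ?expR_ge0.
Qed.

Lemma profile_bound_high (F : R -> R) (A : R) (k : nat) : 0 < A ->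
  (forall x, 0 <= x <= pi / 2 -> is_derive x 1 F (- A * cos x ^+ k.+1)) ->
  F (pi / 2) = 0 ->
  forall a, 0 <= a <= pi / 2 ->
    F a <= expR (- (k.+2%:R / 2) * a ^+ 2) * F 0.
Proof.
move=> A0 Fd Fpi a /andP[a0 api].
have F0 : 0 <= F 0.
  rewrite -[leLHS]Fpi; apply: (@derive_le0_le _ (fun x => - A * cos x ^+ k.+1)) => //.
    by have := pi_ge0 R; lra.
  move=> x /andP[x0 xpi]; rewrite /= mulNr oppr_le0 mulr_ge0 ?(ltW A0)//.
  by rewrite exprn_ge0// cos_ge0_pihalf; lra.
move: api; rewrite le_eqVlt => /predU1P[->|api].
  by rewrite Fpi mulr_ge0 ?expR_ge0.
move: a0; rewrite le_eqVlt => /predU1P[<-|a0].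
  by rewrite expr0n/= mulr0 expR0 mul1r.
pose E x : R := expR (- (k.+2%:R / 2) * x ^+ 2).
have ca : 0 < cos a by apply: cos_gt0_pihalf; lra.
have ck : 0 < cos a ^+ k.+1 by rewrite exprn_gt0.
have E0 x : 0 < E x by exact: expR_gt0.
pose c := k.+2%:R * a * E a / (A * cos a ^+ k.+1).
have c0 : 0 < c by rewrite /c !mulr_gt0 ?invr_gt0 ?mulr_gt0.
pose h := (expR \o ((- (k.+2%:R / 2)) *: id ^+ 2)) - c *: F.
pose h' x := c * (A * cos x ^+ k.+1) - k.+2%:R * (x * E x).
have hd x : 0 <= x <= pi / 2 -> is_derive x 1 h (h' x).
  move=> x01; have := Fd x x01 => ?.
  by apply: is_derive_eq; rewrite !fctE /GRing.scale/= /h' /E; field.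
have cE x : c * (A * cos x ^+ k.+1) =
    k.+2%:R * (a * E a * cos x ^+ k.+1) / cos a ^+ k.+1.
  rewrite /c; field; rewrite ?gt_eqF//.
have up : h 0 <= h a.
  apply: (@derive_ge0_le _ h'); first exact: ltW.
    by move=> x x0a; apply: hd; lra.
  move=> x /andP[x0 xa]; rewrite /h' cE subr_ge0 ler_pdivlMr//.
  rewrite -(mulrA _ (x * E x)) ler_pM2l ?ltr0n//.
  by apply: gauss_ratio_pow_le => //; exact: ltW.
have down : h (pi / 2) <= h a.
  apply: (@derive_le0_le _ h'); first exact: ltW.
    by move=> x x0a; apply: hd; lra.
  move=> x /andP[x0 xa]; rewrite /h' cE subr_le0 ler_pdivrMr//.
  rewrite -(mulrA _ (x * E x)) ler_pM2l ?ltr0n//.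
  by apply: gauss_ratio_pow_le => //; exact: ltW.
move: up down; rewrite /h !fctE /GRing.scale/= -!/(E _) Fpi mulr0 subr0.
rewrite {1}/E expr0n/= mulr0 expR0 => up down.
have Ea1 : E a <= 1.
  by rewrite /E -expR0 ler_expR mulNr oppr_le0 mulr_ge0 ?divr_ge0 ?sqr_ge0.
have Epi := E0 (pi / 2).
rewrite -(ler_pM2l c0) mulrCA -/(E a).
have Eap := E0 a.
have : E a * (1 - c * F 0) <= E a * (E a - c * F a) by rewrite ler_pM2l.
have : 0 <= (1 - E a) * (E a - c * F a) by rewrite mulr_ge0; lra.
lra.
Qed.

Lemma inv3_le_expRN1 : 3^-1 <= expR (-1) :> R.
Proof.
rewrite (_ : -1 = 6%:R * - (1 / 6) :> R); last by field.
rewrite expRM_natl; apply: (@le_trans _ _ ((5 / 6) ^+ 6)); first by lra.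
rewrite lerXn2r// ?nnegrE ?expR_ge0//.
by have := expR_ge1Dx (- (1 / 6) : R); lra.
Qed.

Lemma gauss_ge_linear (a : R) : 0 <= a <= 2 -> 1 - a / 2 <= expR (- (a ^+ 2 / 2)).
Proof.
move=> /andP[a0 a2]; have [a1|a1] := leP a 1.
  by have := expR_ge1Dx (- (a ^+ 2 / 2)); nra.
have h1 := expR_ge1Dx (1 - a ^+ 2 / 2).
have -> : - (a ^+ 2 / 2) = -1 + (1 - a ^+ 2 / 2) by ring.
rewrite expRD; have h2 := inv3_le_expRN1.
apply: (@le_trans _ _ (3^-1 * (2 - a ^+ 2 / 2))); first by nra.
by apply: ler_pM => //; [nra|lra].
Qed.

Lemma profile_bound1 (F : R -> R) (A : R) : 0 < A ->
  (forall x, 0 <= x <= pi / 2 -> is_derive x 1 F (- A)) ->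
  F (pi / 2) = 0 ->
  forall a, 0 <= a <= pi / 2 -> F a <= expR (- (1 / 2) * a ^+ 2) * F 0.
Proof.
move=> A0 Fd Fpi.
have FE a : 0 <= a <= pi / 2 -> F a = A * (pi / 2 - a).
  move=> /andP[a0 api].
  pose G : R -> R := F + A *: id.
  have GE x : G x = F x + A * x by [].
  have d (x : R) : 0 <= x <= pi / 2 -> is_derive x 1 G 0.
    move=> x01; have i1 : is_derive x 1 (id : R -> R) 1 by exact: is_derive_id.
    apply: (is_derive_eq (is_deriveD (Fd x x01) (is_deriveZ A i1))).
    by rewrite /GRing.scale/= mulr1 addNr.
  have d' (x : R) : a <= x <= pi / 2 -> is_derive x 1 G 0 by move=> ?; apply: d; lra.
  have h1 := @derive_ge0_le G (cst 0) a (pi / 2) api d' (fun _ _ => lexx _).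
  have h2 := @derive_le0_le G (cst 0) a (pi / 2) api d' (fun _ _ => lexx _).
  by move: h1 h2; rewrite !GE Fpi; lra.
move=> a ha; have /andP[a0 api] := ha.
have pi1 := pihalf_ge1 R; have pi2 := pihalf_lt2 R.
rewrite !FE//; last by rewrite lexx/=; lra.
rewrite subr0 mulrCA ler_pM2l//.
have a2 : 0 <= a <= 2 by lra.
have := gauss_ge_linear a2.
rewrite (_ : - (1 / 2) * a ^+ 2 = - (a ^+ 2 / 2)); last by field.
set g := expR _ => h.
apply: (@le_trans _ _ ((1 - a / 2) * (pi / 2))); first by nra.
by rewrite ler_wpM2r//; lra.
Qed.

End Calculus.

Section Profile.
Context {R : realType}.

Definition disc_profile (N : nat) (t : R) : R := Num.sqrt (1 - t ^+ 2) ^+ N.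

Lemma continuous_disc_profile N : continuous (disc_profile N).
Proof.
have c1 : continuous (fun t : R => 1 - t ^+ 2).
  by move=> x; apply: cvgB; [exact: cvg_cst|exact: exprn_continuous].
have c2 : continuous (fun t : R => Num.sqrt (1 - t ^+ 2)).
  by move=> x; apply: continuous_comp; [exact: c1|exact: sqrt_continuous].
move=> x; exact: (@continuous_comp _ _ _ (fun t : R => Num.sqrt (1 - t ^+ 2))
  (fun y : R => y ^+ N) x (c2 x) (@exprn_continuous _ N _)).
Qed.

Lemma disc_profile_sin N (x : R) : 0 <= cos x -> disc_profile N (sin x) = cos x ^+ N.
Proof. by move=> cx; rewrite /disc_profile -cos2sin2 sqrtr_sqr ger0_norm. Qed.

(* [P + Q] and [2 * W] are, up to a common factor, the volumes of the cone over
   the cap [sin a < x_1] and of the whole ball in dimension [N + 1]. *)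
Lemma cap_integral_bound (N : nat) (a : R) : (0 < N)%N -> 0 < a < pi / 2 ->
  exists P Q W : R,
  [/\ (\int[lebesgue_measure]_(t in `[0%R, sin a])
         ((t * (cos a / sin a)) ^+ N)%:E = P%:E)%E,
      (\int[lebesgue_measure]_(t in `[sin a, 1%R]) (disc_profile N t)%:E = Q%:E)%E,
      (\int[lebesgue_measure]_(t in `[0%R, 1%R]) (disc_profile N t)%:E = W%:E)%E &
      P + Q <= expR (- (N%:R / 2) * a ^+ 2) * W].
Proof.
move=> N0 /andP[a0 api].
have sa0 : 0 < sin a by apply: sin_gt0_pihalf; rewrite a0.
have sa1 : sin a < 1.
  by rewrite -(sin_pihalf R) ltr_sin ?in_itv/=; lra.
have [H Hd] := @antiderivative_exists R (disc_profile N) (-1) (@continuous_disc_profile N).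
exists (sin a * cos a ^+ N / N.+1%:R), (H 1 - H (sin a)), (H 1 - H 0).
have N1 : N.+1%:R != 0 :> R by rewrite pnatr_eq0.
split.
- pose c := cos a / sin a.
  pose G : R -> R := (c ^+ N / N.+1%:R) *: id ^+ N.+1.
  transitivity ((G (sin a) - G 0)%:E).
    apply: (@integral_antiderivative R (fun t => (t * c) ^+ N)) => //.
      move=> x; exact: (@continuous_comp _ _ _ (fun t : R => t * c)
        (fun y : R => y ^+ N) x (@mulrr_continuous _ _ x) (@exprn_continuous _ N _)).
    move=> x _; have i1 : is_derive x 1 (id : R -> R) 1 by exact: is_derive_id.
    have := is_deriveZ (c ^+ N / N.+1%:R) (is_deriveX N.+1 i1).
    move=> /is_derive_eq; apply.
    by rewrite /GRing.scale/= mulr1 mulrA divfK// -exprMn (mulrC c).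
  congr EFin; rewrite /G !fctE /GRing.scale/= expr0n/= mulr0 subr0 /c.
  by rewrite expr_div_n exprS; field; rewrite nat1r N1 expf_neq0// gt_eqF.
- apply: integral_antiderivative => //; first exact: continuous_disc_profile.
  by move=> x /andP[xa _]; apply: Hd; lra.
- apply: integral_antiderivative => //; first exact: continuous_disc_profile.
  by move=> x /andP[xa _]; apply: Hd; lra.
pose A : R := N%:R / N.+1%:R.
have A0 : 0 < A by rewrite divr_gt0// ltr0n.
pose F : R -> R := N.+1%:R^-1 *: (sin * cos ^+ N) - (H \o sin) + cst (H 1).
have FE x : F x = N.+1%:R^-1 * (sin x * cos x ^+ N) - H (sin x) + H 1.
  by rewrite /F !fctE.
have Fd x : 0 <= x <= pi / 2 -> is_derive x 1 F (- A * cos x ^+ N.-1).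
  move=> /andP[x0 xpi].
  have s0 : 0 <= sin x by apply: sin_ge0_pihalf; rewrite x0.
  have c0 : 0 <= cos x by apply: cos_ge0_pihalf; lra.
  have Hs : is_derive (sin x) 1 H (cos x ^+ N).
    by rewrite -disc_profile_sin//; apply: Hd; lra.
  have d1 := is_deriveM (is_derive_sin x) (is_deriveX N (is_derive_cos x)).
  have d2 := is_derive1_comp Hs (is_derive_sin x).
  have d3 := is_derive_cst (H 1) x (1 : R).
  have := is_deriveD (is_deriveB (is_deriveZ N.+1%:R^-1 d1) d2) d3.
  move=> /is_derive_eq; apply.
  rewrite !fctE /GRing.scale/= /A.
  have -> : cos x ^+ N = cos x * cos x ^+ N.-1 by rewrite -exprS prednK.
  have s2 := sin2cos2 x.
  transitivity (N.+1%:R^-1 * (- (N%:R * cos x ^+ N.-1 * sin x ^+ 2) +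
    cos x ^+ 2 * cos x ^+ N.-1) - cos x ^+ 2 * cos x ^+ N.-1); first by ring.
  by rewrite s2 -natr1; field; rewrite natr1.
have Fpi : F (pi / 2) = 0.
  rewrite FE sin_pihalf cos_pihalf expr0n.
  by rewrite eqn0Ngt N0/=; ring.
have F0 : F 0 = H 1 - H 0.
  by rewrite FE sin0; ring.
have -> : sin a * cos a ^+ N / N.+1%:R + (H 1 - H (sin a)) = F a.
  by rewrite FE; ring.
rewrite -F0; have a01 : 0 <= a <= pi / 2 by rewrite !ltW.
clear FE F0; clearbody F A; move: N0 A0 Fd; clear - Fpi a01.
case: N => [//|[|k]] _ A0 Fd; last exact: (profile_bound_high A0).
by apply: (profile_bound1 A0) => // x x01; have := Fd x x01; rewrite mulr1.
Qed.

End Profile.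

(** * Volume of caps *)

Section CapVolume.
Context {R : realType} {N : nat}.
Hypothesis N0 : (0 < N)%N.
Local Notation leb := (@lebesgue_measure R).
Variable lam : {sigma_finite_measure set (N.-tuple R) -> \bar R}.
Hypothesis hlam : is_lebesgue lam.

Lemma lebesgue_eball (r : R) : 0 <= r ->
  lam (eball N r) = ((r ^+ N)%:E * lam (eball N 1))%E.
Proof.
rewrite le_eqVlt => /predU1P[<-|r0]; last exact: lebesgue_eball_scale.
rewrite expr0n eqn0Ngt N0 mul0e; apply/eqP; rewrite eq_le measure_ge0 andbT.
have <- : lam (box N 0) = 0%E.
  by rewrite lebesgue_box// mulr0 expr0n eqn0Ngt N0.
apply: le_measure; rewrite ?inE; [exact: measurable_eball|exact: measurable_box|].
exact: eball_sub_box.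
Qed.

Lemma dotp_tcons (t : R) (y : N.-tuple R) :
  dotp (tcons (t, y)) (tcons (t, y)) = t ^+ 2 + dotp y y.
Proof.
rewrite /dotp big_ord_recl tnth_tcons0 expr2; congr (_ + _).
by apply: eq_bigr => i _; rewrite tnth_tconsS.
Qed.

Definition slice (B : set (N.+1.-tuple R)) (t : R) : set (N.-tuple R) :=
  [set y | B (tcons (t, y))].

Lemma iint_slice (B : set (N.+1.-tuple R)) : measurable B ->
  (forall t, measurable (slice B t)) /\
  measurable_fun setT ((fun t => lam (slice B t)) : measurableTypeR R -> \bar R) /\
  iint (fun x => (\1_B x : R)%:E) = (\int[leb]_t lam (slice B t))%E.
Proof.
move=> mB.
have ms t : measurable (slice B t).
  have m2 : measurable_fun setT (fun y : N.-tuple R => tcons (t, y)).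
    apply: (measurable_fun_pair2 (f := @tcons R N)).
    exact: measurable_tcons.
  exact: measurable_preimage m2 mB.
have mf : measurable_fun setT (fun x => (\1_B x : R)%:E).
  by apply/measurable_EFinP; exact: measurable_indic.
have f0 x : (0 <= (\1_B x : R)%:E)%E by rewrite lee_fin.
have [mg _] := measurable_iint_cons hlam mf f0.
have E : (fun t => lam (slice B t)) =
    (fun t => iint (fun y => (\1_B (tcons (t, y)) : R)%:E)).
  by apply/funext => t; rewrite (lebesgue_iint hlam).
split=> //; split; first by rewrite E.
by apply: eq_integral => t _; rewrite (lebesgue_iint hlam).
Qed.

Definition cap (s : R) : set (N.+1.-tuple R) :=
  usphere N.+1 `&` [set x | s < tnth x ord0].

Lemma measurable_cap s : measurable (cap s).
Proof.
apply: measurableI; first exact: measurable_usphere.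
rewrite (_ : mkset _ = (fun x => tnth x ord0) @^-1` `]s, +oo[).
  by apply: measurable_preimage; [exact: measurable_tnth|exact: measurable_itv].
by apply/seteqP; split => x /=; rewrite in_itv/= andbT.
Qed.

Lemma cone_capP s (x : N.+1.-tuple R) : cone (cap s) x <->
  0 < enorm x <= 1 /\ s * enorm x < tnth x ord0.
Proof.
split=> [[/[dup] h /andP[h1 _] [_ /=]]|[/[dup] h /andP[h1 _] h2]].
  by rewrite tnth_map ltr_pdivlMr.
split => //; split; first exact: enorm_normalize.
by rewrite /= tnth_map ltr_pdivlMr.
Qed.

Lemma sqr_enorm_tcons (t : R) (y : N.-tuple R) :
  enorm (tcons (t, y)) ^+ 2 = t ^+ 2 + enorm y ^+ 2.
Proof. by rewrite !sqr_enorm dotp_tcons. Qed.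

Lemma slice_cap_pos s t : 0 <= s -> t <= 0 -> slice (cone (cap s)) t = set0.
Proof.
move=> s0 t0; apply/seteqP; split => // y /cone_capP[_]; rewrite tnth_tcons0.
by have := mulr_ge0 s0 (enorm_ge0 (tcons (t, y))); lra.
Qed.

Lemma slice_cap_disc s t :
  slice (cone (cap s)) t `<=`
  [set y | t ^+ 2 <= 1 /\ enorm y <= Num.sqrt (1 - t ^+ 2)].
Proof.
move=> y /cone_capP[/andP[x0 x1] _].
have h : t ^+ 2 + enorm y ^+ 2 <= 1.
  by rewrite -sqr_enorm_tcons expr_le1// ltW.
have h0 := sqr_ge0 (enorm y).
split; first by lra.
by rewrite -[leLHS]ger0_norm ?enorm_ge0// -sqrtr_sqr ler_wsqrtr//; lra.
Qed.

Lemma slice_cap_cone a t : 0 < a < pi / 2 -> 0 <= t ->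
  slice (cone (cap (sin a))) t `<=` eball N (t * (cos a / sin a)).
Proof.
move=> /andP[a0 api] t0 y /cone_capP[_]; rewrite tnth_tcons0 => h.
have s0 : 0 < sin a by apply: sin_gt0_pihalf; rewrite a0.
have c0 : 0 < cos a by apply: cos_gt0_pihalf; lra.
have h2 : (sin a * enorm (tcons (t, y))) ^+ 2 <= t ^+ 2.
  by rewrite ler_sqr ?nnegrE ?mulr_ge0 ?enorm_ge0// ltW.
rewrite /eball/= mulrA ler_pdivlMr// -ler_sqr ?nnegrE ?mulr_ge0 ?enorm_ge0
  ?(ltW s0) ?(ltW c0)//.
move: h2; rewrite !exprMn sqr_enorm_tcons sin2cos2; lra.
Qed.

Lemma lebesgue_disc (t : R) :
  lam (eball N (Num.sqrt (1 - t ^+ 2))) =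
  ((disc_profile N t)%:E * lam (eball N 1))%E.
Proof. by rewrite lebesgue_eball ?sqrtr_ge0. Qed.

Variable mu : {finite_measure set (N.+1.-tuple R) -> \bar R}.
Hypothesis hmu : is_cone_measure mu.

Lemma cone_measure_cap_le (a P Q : R) : 0 < a < pi / 2 ->
  (\int[leb]_(t in `[0%R, sin a]) ((t * (cos a / sin a)) ^+ N)%:E = P%:E)%E ->
  (\int[leb]_(t in `[sin a, 1%R]) (disc_profile N t)%:E = Q%:E)%E ->
  (mu (cap (sin a)) <= lam (eball N 1) * (P + Q)%:E)%E.
Proof.
move=> /[dup] ha /andP[a0 api] hP hQ.
have s0 : 0 < sin a by apply: sin_gt0_pihalf; rewrite a0.
have c0 : 0 < cos a by apply: cos_gt0_pihalf; lra.
have mC := measurable_cone (measurable_cap (sin a)).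
have [ms [mg E]] := iint_slice mC.
rewrite hmu; last exact: measurable_cap.
rewrite E.
pose f1 (t : R) := (((t * (cos a / sin a)) ^+ N)%:E)%E.
pose f2 (t : R) := ((disc_profile N t)%:E)%E.
have mf1 : measurable_fun setT (f1 : measurableTypeR R -> \bar R).
  apply/measurable_EFinP; apply: measurable_funX.
  by apply: measurable_funM => //; exact: measurable_cst.
have mf2 : measurable_fun setT (f2 : measurableTypeR R -> \bar R).
  apply/measurable_EFinP; apply: continuous_measurable_fun.
  exact: continuous_disc_profile.
pose g t := ((f1 \_ `[0%R, sin a]) t + (f2 \_ `[sin a, 1%R]) t)%E.
have g10 t : (0 <= (f1 \_ `[0%R, sin a]) t)%E.
  rewrite patchE; case: ifPn => //; rewrite inE/= in_itv/= => /andP[t0 _].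
  by rewrite lee_fin exprn_ge0// mulr_ge0// divr_ge0// ltW.
have g20 t : (0 <= (f2 \_ `[sin a, 1%R]) t)%E.
  rewrite patchE; case: ifPn => // _.
  by rewrite lee_fin exprn_ge0// sqrtr_ge0.
have mg1 : measurable_fun setT ((f1 \_ `[0%R, sin a]) : measurableTypeR R -> \bar R).
  apply: (measurable_restrictT _ _).1; first exact: measurable_itv.
  exact: measurable_funTS.
have mg2 : measurable_fun setT ((f2 \_ `[sin a, 1%R]) : measurableTypeR R -> \bar R).
  apply: (measurable_restrictT _ _).1; first exact: measurable_itv.
  exact: measurable_funTS.
have w0 : (0 <= lam (eball N 1))%E by exact: measure_ge0.
apply: (@le_trans _ _ (\int[leb]_t (lam (eball N 1) * g t))%E); last first.
  rewrite ge0_integralZl//.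
  - by rewrite ge0_integralD// -!integral_mkcond hP hQ EFinD.
  - exact: emeasurable_funD.
  - by move=> t _; rewrite adde_ge0.
apply: ge0_le_integral => //.
  by apply: measurable_funeM; exact: emeasurable_funD.
move=> t _.
have [t0|t0] := leP t 0.
  rewrite slice_cap_pos// ?(ltW s0)// measure0.
  by rewrite mule_ge0// adde_ge0.
have [ts|ts] := leP t (sin a).
  apply: (@le_trans _ _ (lam (eball N 1) * f1 t)%E); last first.
    apply: lee_wpmul2l => //; rewrite /g -[leLHS]adde0 leeD//.
    by rewrite patchE mem_set//= in_itv/= ts ltW.
  rewrite muleC -lebesgue_eball; last by rewrite mulr_ge0 ?divr_ge0 ?ltW.
  apply: le_measure; rewrite ?inE//; first exact: measurable_eball.
  by apply: slice_cap_cone => //; exact: ltW.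
have [t1|t1] := leP t 1.
  apply: (@le_trans _ _ (lam (eball N 1) * f2 t)%E); last first.
    apply: lee_wpmul2l => //; rewrite /g -[leLHS]add0e leeD//.
    by rewrite [leRHS]patchE mem_set//= in_itv/= t1 ltW.
  rewrite muleC -lebesgue_disc.
  apply: le_measure; rewrite ?inE//; first exact: measurable_eball.
  by move=> y /slice_cap_disc[].
rewrite (_ : slice _ t = set0) ?measure0 ?mule_ge0 ?adde_ge0//.
apply/seteqP; split => // y /slice_cap_disc[] + _.
by rewrite expr_le1 ?(ltW t0)// leNgt t1.
Qed.

Lemma cone_measure_halfsphere_ge (W : R) :
  (\int[leb]_(t in `[0%R, 1%R]) (disc_profile N t)%:E = W%:E)%E ->
  (lam (eball N 1) * W%:E <= mu (cap 0))%E.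
Proof.
move=> hW; have mC := measurable_cone (measurable_cap 0).
have [ms [mg E]] := iint_slice mC.
rewrite hmu; last exact: measurable_cap.
rewrite E -hW.
pose f2 (t : R) := ((disc_profile N t)%:E)%E.
have mf2 : measurable_fun setT (f2 : measurableTypeR R -> \bar R).
  apply/measurable_EFinP; apply: continuous_measurable_fun.
  exact: continuous_disc_profile.
have w0 : (0 <= lam (eball N 1))%E by exact: measure_ge0.
have g20 t : (0 <= (f2 \_ `]0%R, 1%R]) t)%E.
  rewrite patchE; case: ifPn => // _.
  by rewrite lee_fin exprn_ge0// sqrtr_ge0.
have mg2 : measurable_fun setT ((f2 \_ `]0, 1]) : measurableTypeR R -> \bar R).
  apply: (measurable_restrictT _ _).1; first exact: measurable_itv.
  exact: measurable_funTS.
rewrite -integral_itv_obnd_cbnd; last exact: measurable_funTS.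
rewrite integral_mkcond -ge0_integralZl//.
apply: ge0_le_integral => //.
- by move=> t _; rewrite mule_ge0.
- exact: measurable_funeM.
move=> t _; rewrite patchE; case: ifPn; last by rewrite mule0.
rewrite inE/= in_itv/= => /andP[t0 t1].
rewrite muleC -lebesgue_disc; apply: le_measure; rewrite ?inE//.
  exact: measurable_eball.
move=> y; rewrite /eball/= => hy; apply/cone_capP.
have e2 : 0 < enorm (tcons (t, y)) ^+ 2.
  by rewrite sqr_enorm_tcons ltr_pwDl ?exprn_gt0 ?sqr_ge0.
have e0 : 0 < enorm (tcons (t, y)).
  rewrite lt_def enorm_ge0 andbT; apply/eqP => h; move: e2; rewrite h expr0n ltxx//.
rewrite mul0r tnth_tcons0; split=> //; rewrite e0/=.
rewrite -(@expr_le1 _ 2)// ?enorm_ge0// sqr_enorm_tcons.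
have t2 : 0 <= 1 - t ^+ 2 by rewrite subr_ge0 expr_le1// ltW.
have : enorm y ^+ 2 <= Num.sqrt (1 - t ^+ 2) ^+ 2.
  by rewrite ler_sqr ?nnegrE ?enorm_ge0 ?sqrtr_ge0.
by rewrite sqr_sqrtr//; lra.
Qed.

End CapVolume.

(** * Concentration of measure *)

Section Final.
Context {R : realType}.

Definition basis_vector n (k : 'I_n) : n.-tuple R := [tuple (i == k)%:R | i < n].

Lemma dotp_basis_vector n (k : 'I_n) (x : n.-tuple R) :
  dotp x (basis_vector k) = tnth x k.
Proof.
rewrite /dotp (bigD1 k)//= tnth_mktuple eqxx mulr1 big1 ?addr0// => i ik.
by rewrite tnth_mktuple (negbTE ik) mulr0.
Qed.

Lemma exists_orthogonal N (x : N.+1.-tuple R) : (0 < N)%N -> dotp x x = 1 ->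
  exists w, dotp w w = 1 /\ dotp w x = 0.
Proof.
move=> N0 x1.
pose k0 : 'I_N.+1 := ord0; pose k1 : 'I_N.+1 := Ordinal (N0 : 1 < N.+1)%N.
have : tnth x k0 ^+ 2 + tnth x k1 ^+ 2 <= 1.
  rewrite -x1 /dotp (bigD1 k0)//= (bigD1 k1)//= -!expr2 addrA lerDl.
  by apply: sumr_ge0 => i _; rewrite -expr2 sqr_ge0.
move=> h; have [k hk] : exists k, tnth x k ^+ 2 < 1.
  have [h0|h0] := ltP (tnth x k0 ^+ 2) 1; first by exists k0.
  by exists k1; apply: le_lt_trans (_ : 0 < 1); [lra|].
set b := basis_vector k.
have bb : dotp b b = 1 by rewrite dotp_basis_vector tnth_mktuple eqxx.
have xb : dotp x b = tnth x k by exact: dotp_basis_vector.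
pose r := Num.sqrt (1 - tnth x k ^+ 2).
have r2 : r ^+ 2 = 1 - tnth x k ^+ 2 by rewrite sqr_sqrtr// subr_ge0 ltW.
have r0 : 0 < r by rewrite sqrtr_gt0 subr_gt0.
exists (lincomb r^-1 b (- tnth x k / r) x); split.
  rewrite !dotp_lincomb (dotpC b x) bb xb x1.
  rewrite (_ : _ + _ = (1 - tnth x k ^+ 2) / r ^+ 2); last by field; exact: lt0r_neq0.
  by rewrite -r2 divff// expf_neq0// lt0r_neq0.
by rewrite dotp_lincombl (dotpC b x) xb x1; field; exact: lt0r_neq0.
Qed.

Lemma acos_le_of_cos (d b : R) : -1 <= d <= 1 -> 0 <= b <= pi -> cos b <= d ->
  acos d <= b.
Proof.
move=> d1 /andP[b0 bpi]; rewrite -{1}(@acosK _ d) ?in_itv//= => h.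
rewrite leNgt; apply/negP => hb; move: h; apply/negP; rewrite -ltNge ltr_cos//.
  by rewrite in_itv/= b0.
by rewrite in_itv/= acos_ge0// acos_lepi.
Qed.

Lemma dotp_sphere_bound n (x y : n.-tuple R) : usphere n x -> usphere n y ->
  -1 <= dotp x y <= 1.
Proof.
move=> xS yS; have := cauchy_schwarz x y.
rewrite (iffLR (usphereP x) xS) (iffLR (usphereP y) yS) mulr1 => h.
by rewrite -ler_norml -(@expr_le1 _ 2)// real_normK ?num_real.
Qed.

Section Concentration.
Context {N : nat} (mu : {finite_measure set (N.+1.-tuple R) -> \bar R}).
Hypotheses (N0 : (0 < N)%N) (hmu : is_cone_measure mu).

Lemma cone_measure_cap_bound (a : R) : 0 < a < pi / 2 ->
  (mu (cap (sin a)) + mu (cap (sin a)) <=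
   (expR (- (N%:R / 2) * a ^+ 2))%:E * mu (usphere N.+1))%E.
Proof.
move=> ha; have [P [Q [W [hP hQ hW PQ]]]] := cap_integral_bound N0 ha.
have [lam hlam] := @lebesgue_tuple_exists R N.
have h1 := cone_measure_cap_le N0 hlam hmu ha hP hQ.
have h2 := cone_measure_halfsphere_ge N0 hlam hmu hW.
set E := expR _ in PQ *.
have E0 : 0 <= E by exact: expR_ge0.
have h3 : (mu (cap (sin a)) <= E%:E * mu (cap 0))%E.
  apply: le_trans h1 _; apply: (@le_trans _ _ (lam (eball N 1) * (E * W)%:E)%E).
    by apply: lee_wpmul2l => //; rewrite lee_fin.
  by rewrite EFinM muleCA; apply: lee_wpmul2l; rewrite ?lee_fin.
apply: (@le_trans _ _ (E%:E * (mu (cap 0) + mu (cap 0)))%E).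
  by rewrite ge0_muleDr//; exact: leeD.
apply: lee_wpmul2l; rewrite ?lee_fin//.
pose e := basis_vector (ord0 : 'I_N.+1).
have ee : dotp e e = 1 by rewrite dotp_basis_vector tnth_mktuple eqxx.
have mc := @measurable_cap R N 0.
rewrite -{2}(cone_measure_mirror hmu ee mc) -measureU//.
- apply: le_measure; rewrite ?inE//.
  + apply: measurableU => //.
    by apply: measurable_preimage => //; exact: measurable_mirror.
  + exact: measurable_usphere.
  + by move=> x [[]//|[/= xS _]]; apply/(usphere_mirror x ee).
- by apply: measurable_preimage => //; exact: measurable_mirror.
- apply/seteqP; split => // x [[_ /= x0] [_ /=]].
  by rewrite -dotp_basis_vector dotp_mirror_pole// dotp_basis_vector; lra.
Qed.

Lemma concentration (A : set (N.+1.-tuple R)) (b : R) : measurable A ->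
  A `<=` usphere N.+1 -> (mu (usphere N.+1) <= mu A + mu A)%E ->
  0 < b <= pi / 2 ->
  exists B, [/\ measurable B,
    B `<=` [set x | usphere N.+1 x /\ exists2 y, A y & cos b <= dotp x y] &
    (mu (usphere N.+1 `\` B) + mu (usphere N.+1 `\` B) <=
     (expR (- (N%:R / 2) * b ^+ 2))%:E * mu (usphere N.+1))%E].
Proof.
move=> mA AS hA hb; have /andP[b0 bpi] := hb.
pose v := basis_vector (ord0 : 'I_N.+1).
pose e := lincomb (-1) v 0 v.
have vv : dotp v v = 1 by rewrite dotp_basis_vector tnth_mktuple eqxx.
have ee : dotp e e = 1 by rewrite !dotp_lincomb vv; ring.
have ex x : dotp x e = - tnth x ord0.
  by rewrite dotp_lincombr dotp_basis_vector; ring.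
have [w [ww we]] := exists_orthogonal N0 ee.
have [B [mB BS Bcap]] := neighbourhood_measure hmu ee ww we mA AS hA hb.
exists B; split=> //.
have mS := @measurable_usphere R N.+1.
have Tfin : mu (usphere N.+1) \is a fin_num by exact: fin_num_measure.
have BSS : B `<=` usphere N.+1 by move=> x /BS[].
have Sa a : 0 < a < b -> (mu (usphere N.+1 `\` B) <= mu (cap (sin a)))%E.
  move=> ab; have mc := @measurable_cap R N (sin a).
  have capE : usphere N.+1 `\` cap (sin a) =
      usphere N.+1 `&` [set x | - sin a <= dotp x e].
    apply/seteqP; split => x [xS h]; split => //.
      by rewrite /= ex lerN2 leNgt; apply/negP => h'; exact: h.
    by move: h; rewrite /= ex lerN2 => h [_ /=]; rewrite ltNge h.
  have muD X : measurable X -> X `<=` usphere N.+1 ->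
      mu (usphere N.+1 `\` X) = (mu (usphere N.+1) - mu X)%E.
    move=> mX XS; rewrite measureD//; first by rewrite setIidr.
    by rewrite -ge0_fin_numE.
  have Bf : mu B \is a fin_num by exact: fin_num_measure.
  have Cf : mu (cap (sin a)) \is a fin_num by exact: fin_num_measure.
  have := Bcap a ab; rewrite -capE !muD//; last by move=> x [].
  rewrite -(fineK Tfin) -(fineK Bf) -(fineK Cf) -!EFinB !lee_fin; lra.
have Df : mu (usphere N.+1 `\` B) \is a fin_num.
  by apply: fin_num_measure; exact: measurableD.
have K a : 0 < a < b ->
    fine (mu (usphere N.+1 `\` B)) * 2 <=
    expR (- (N%:R / 2) * a ^+ 2) * fine (mu (usphere N.+1)).
  move=> ab; have ap : 0 < a < pi / 2 by case/andP: ab => *; lra.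
  have := le_trans (leeD (Sa a ab) (Sa a ab)) (cone_measure_cap_bound ap).
  by rewrite -(fineK Df) -(fineK Tfin) -EFinD -EFinM lee_fin; lra.
rewrite -(fineK Df) -(fineK Tfin) -EFinD -EFinM lee_fin.
rewrite (_ : _ + _ = fine (mu (usphere N.+1 `\` B)) * 2); last by ring.
set D := fine _ * 2; set T := fine (mu (usphere N.+1)) in K *.
have cf : {for b, continuous (fun a : R => expR (- (N%:R / 2) * a ^+ 2) * T)}.
  apply: continuousM; last exact: cst_continuous.
  apply: continuous_comp; last exact: continuous_expR.
  apply: continuousM; first exact: cst_continuous.
  exact: exprn_continuous.
have cl : (fun a : R => expR (- (N%:R / 2) * a ^+ 2) * T) a @[a --> b^'-] -->
    expR (- (N%:R / 2) * b ^+ 2) * T.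
  exact: cvg_at_left_filter cf.
apply: (cvgr_to_ge cl).
near=> a; apply: K; apply/andP; split; near: a.
  exact: nbhs_left_gt.
exact: nbhs_left_lt.
Unshelve. all: by end_near. Qed.

End Concentration.
End Final.

Section Assembly.
Context {R : realType}.

Lemma sqrt_pi8_ge : 1 / 2 <= Num.sqrt (pi / 8) :> R.
Proof.
rewrite -[leLHS]ger0_norm// -sqrtr_sqr ler_wsqrtr//.
have := pi_ge2 R; lra.
Qed.

Lemma geodist_neighbour n (A : set (n.-tuple R)) (x : n.-tuple R) (b eps : R) :
  A `<=` usphere n -> usphere n x -> 0 <= b <= pi -> b <= eps ->
  (exists2 y, A y & cos b <= dotp x y) -> exists2 y, A y & geodist x y <= eps.
Proof.
move=> AS xS bpi be [y Ay xy]; exists y => //; apply: le_trans be.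
by apply: acos_le_of_cos => //; apply: dotp_sphere_bound => //; exact: AS.
Qed.

Lemma neighbour_obtuse N (mu : {finite_measure set (N.+1.-tuple R) -> \bar R})
    (A : set (N.+1.-tuple R)) (x : N.+1.-tuple R) (eps : R) :
  (0 < N)%N -> is_cone_measure mu -> measurable A ->
  (mu (usphere N.+1) <= mu A + mu A)%E -> A `<=` usphere N.+1 ->
  usphere N.+1 x -> pi / 2 < eps -> exists2 y, A y & geodist x y <= eps.
Proof.
move=> N0 hmu mA hA AS xS he; pose b := Num.min eps pi.
have pi0 := pi_gt0 R.
have bpi : pi / 2 < b by rewrite lt_min he; lra.
have b2 : b <= pi by rewrite ge_min lexx orbT.
apply: (@geodist_neighbour _ A x b eps AS xS) => //; first by rewrite b2; lra.
  by rewrite ge_min lexx.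
have x1 := iffLR (usphereP x) xS.
pose e := lincomb (-1) x 0 x.
have ee : dotp e e = 1 by rewrite !dotp_lincomb x1; ring.
have [w [ww we]] := exists_orthogonal N0 ee.
have d0 : 0 < - cos b.
  rewrite oppr_gt0 -(cos_pihalf R) ltr_cos// in_itv/=; apply/andP; split; lra.
have [y [_ Ay ye]] := low_point hmu ee ww we hA mA (lexx _) d0.
by exists y => //; move: ye; rewrite dotp_lincombr (dotpC y x); lra.
Qed.

End Assembly.

Unset Implicit Arguments.

Theorem theorem1 (R : realType) (n m : nat) (rho : 'I_m -> n.-tuple R -> R)
  (C : n.-tuple R -> 'I_m) (c : 'I_m) (eps : R) :
  (2 <= n)%N ->
  (forall k, bounded_density (rho k)) ->
  (forall k, measurable (usphere n `&` [set x | C x = k])) ->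
  (surf1 (usphere n `&` [set x | C x = c]) <= (1 / 2)%:E)%E ->
  0 < eps ->
  exists B : set (n.-tuple R),
    [/\ measurable B,
        B `<=` [set x | usphere n x /\
                  (C x != c \/
                   exists xh, [/\ usphere n xh, C xh != c & geodist x xh <= eps])]
      & ((1 - (sarea n * sup (rho c @` usphere n))
              * Num.sqrt (pi / 8) * expR (- ((n%:R - 1) / 2) * eps ^+ 2))%:E
           <= surf_int B (rho c))%E].
Proof.
case: n rho C => [//|[//|N]] rho C _ hrho mC hcap eps0.
have [mu [hmu hint]] := @cone_measure_exists R N.+2.
have [mrho [rho0 [[M rhoM] rho1]]] := hrho c.
have mS := @measurable_usphere R N.+2.
have fin X : measurable X -> mu X \is a fin_num by move=> ?; exact: fin_num_measure.
have Tf := fin _ mS.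
pose T := fine (mu (usphere N.+2)).
have surfE X : measurable X -> surf X = (N.+2%:R%:E * mu X)%E.
  by move=> mX; rewrite /surf hmu.
have sareaE : sarea N.+2 = N.+2%:R * T :> R.
  by rewrite /sarea surfE// -(fineK Tf) -EFinM.
pose v := basis_vector (ord0 : 'I_N.+2) : N.+2.-tuple R.
have vS : usphere N.+2 v.
  by apply/usphereP; rewrite dotp_basis_vector tnth_mktuple eqxx.
have T0 : 0 < T.
  rewrite fine_gt0// -ge0_fin_numE// Tf andbT.
  apply: lt_le_trans (cone_measure_ball_gt0 hmu vS ltr01) _.
  have mb := measurable_eudist_ball v 1.
  rewrite (measure_sphere hmu mb); apply: le_measure; rewrite ?inE//.
  exact: measurableI.
pose K := usphere N.+2 `&` [set x | C x = c].
have mK : measurable K by exact: mC.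
pose A := usphere N.+2 `\` K.
have mA : measurable A by exact: measurableD.
have AS : A `<=` usphere N.+2 by move=> x [].
have AC y : A y -> C y != c.
  by move=> [yS yK]; apply/eqP => yc; exact: yK.
have hA : (mu (usphere N.+2) <= mu A + mu A)%E.
  have -> : mu A = (mu (usphere N.+2) - mu K)%E.
    rewrite measureD//; first by rewrite setIidr// => x [].
    by rewrite -ge0_fin_numE.
  move: hcap; rewrite /surf1 -/K surfE// sareaE -(fineK (fin _ mK)) -(fineK Tf) -/T.
  rewrite -!EFinM -!EFinB !lee_fin invfM mulrACA divff ?pnatr_eq0// !mul1r.
  rewrite ler_pdivrMr//; lra.
have good B :
    (forall x, B x ->
      usphere N.+2 x /\ exists2 y, A y & geodist x y <= eps) ->
    B `<=` [set x | usphere N.+2 x /\ (C x != c \/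
      exists xh, [/\ usphere N.+2 xh, C xh != c & geodist x xh <= eps])].
  move=> h x /h [xS [y Ay xy]]; split=> //; right; exists y.
  by split => //; [exact: AS|exact: AC].
pose Mx := sup (rho c @` usphere N.+2).
have rhoMx x : usphere N.+2 x -> rho c x <= Mx.
  move=> xS; apply: ub_le_sup; last by exists x.
  by exists M => _ [y yS <-]; exact: rhoM.
have Mx0 : 0 <= Mx by apply: le_trans (rho0 v vS) (rhoMx v vS).
have mrhoB B : B `<=` usphere N.+2 -> measurable_fun B (rho c).
  by move=> BS; apply: measurable_funS mrho.
have siE B : measurable B -> B `<=` usphere N.+2 ->
    surf_int B (rho c) = (N.+2%:R%:E * \int[mu]_(x in B) (rho c x)%:E)%E.
  by move=> mB BS; rewrite /surf_int hint// => [|x /BS]; [exact: mrhoB|exact: rho0].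
set E := expR _; have E0 : 0 <= E by exact: expR_ge0.
have loss0 : 0 <= sarea N.+2 * Mx * Num.sqrt (pi / 8) * E.
  by rewrite sareaE !mulr_ge0 ?sqrtr_ge0// ltW.
have [epi|epi] := leP eps (pi / 2); last first.
  exists (usphere N.+2); split => //.
    apply: good => x xS; split => //.
    exact: (neighbour_obtuse (ltn0Sn N) hmu mA hA AS xS epi).
  by rewrite rho1 lee_fin -/Mx; lra.
have ep : 0 < eps <= pi / 2 by rewrite eps0.
have [B [mB BS hB]] := concentration (ltn0Sn N) hmu mA AS hA ep.
have BSS : B `<=` usphere N.+2 by move=> x /BS[].
exists B; split => //.
  apply: good => x /BS[xS hx]; split => //.
  apply: (@geodist_neighbour _ _ A x eps eps AS xS) => //.
  have := pi_gt0 R; lra.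
have mD : measurable (usphere N.+2 `\` B) by exact: measurableD.
have Df := fin _ mD.
rewrite siE//.
have DS : usphere N.+2 `\` B `<=` usphere N.+2 by move=> x [].
have hD : (\int[mu]_(x in usphere N.+2 `\` B) (rho c x)%:E <=
           Mx%:E * mu (usphere N.+2 `\` B))%E.
  rewrite -integral_cst//; apply: ge0_le_integral => //.
  - by move=> x [xS _]; rewrite lee_fin rho0.
  - by apply/measurable_EFinP; exact: mrhoB.
  - by move=> x [xS _]; rewrite lee_fin rhoMx.
have ID0 : (0 <= \int[mu]_(x in usphere N.+2 `\` B) (rho c x)%:E)%E.
  by apply: integral_ge0 => x [xS _]; rewrite lee_fin rho0.
have IB0 : (0 <= \int[mu]_(x in B) (rho c x)%:E)%E.
  by apply: integral_ge0 => x /BSS xS; rewrite lee_fin rho0.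
have tot : (N.+2%:R%:E * (\int[mu]_(x in B) (rho c x)%:E +
    \int[mu]_(x in usphere N.+2 `\` B) (rho c x)%:E) = 1)%E.
  rewrite -rho1 siE// -ge0_integral_setU//.
  - by rewrite setDUK.
  - by rewrite setDUK//; apply/measurable_EFinP.
  - by rewrite setDUK// => x xS; rewrite lee_fin rho0.
  - by apply/disj_setPS; rewrite setDE setICA setICr setI0.
move: tot hD ID0 IB0 hB.
rewrite -(fineK Df) -(fineK Tf) -/T.
set D := fine (mu (usphere N.+2 `\` B)).
move: (\int[mu]_(x in B) _)%E (\int[mu]_(x in _ `\` B) _)%E => IB ID.
case: ID => [ID| |]; last 2 first.
- by rewrite leye_eq.
- by rewrite leeNy_eq.
case: IB => [IB| |]; last 2 first.
- by rewrite /= gt0_muley ?lte_fin// => /eqP; rewrite eqe.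
- by move=> _ _ _; rewrite leeNy_eq.
rewrite -!EFinD -!EFinM !lee_fin => -[tot] hD ID0 IB0 hB.
have hs := @sqrt_pi8_ge R; set s := Num.sqrt _ in hs *.
have EE : expR (- (N.+1%:R / 2) * eps ^+ 2) = E.
  by rewrite /E; congr (expR (- (_ / 2) * _)); rewrite -(natr1 N.+1) addrK.
rewrite EE in hB.
rewrite sareaE -/Mx.
have n0 : 0 <= N.+2%:R :> R by [].
have h1 : N.+2%:R * ID <= N.+2%:R * (Mx * D) by rewrite ler_wpM2l.
have h2 : Mx * (D + D) <= Mx * (E * T) by rewrite ler_wpM2l.
have h3 : N.+2%:R * (Mx * (D + D)) <= N.+2%:R * (Mx * (E * T)) by rewrite ler_wpM2l.
have h4 : 1 / 2 * (N.+2%:R * (Mx * (E * T))) <= s * (N.+2%:R * (Mx * (E * T))).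
  by rewrite ler_wpM2r// !mulr_ge0// ltW.
lra.
Qed.
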